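(* Let $\mathcal V,\mathcal H,\mathcal Q$ and the linear operators $\mathcal A,\mathcal B,\mathcal D$ be as in the context (inf--sup stable $\mathcal B$; $\mathcal A=\mathcal A_1+\mathcal A_2$ elliptic on $\mathcal V_{\ker}=\ker\mathcal B$; monotone damping operator $\mathcal D$), and let $f$ satisfy the classical Carathéodory condition and the local Lipschitz condition stated in the context. Consider consistent initial data $u^0=u^0_{\ker}+\mathcal B^-g(0)$ with $u^0_{\ker}$ in the domain of $\mathcal A_{\ker}$ and $w^0=w^0_{\ker}+\mathcal B^-\dot g(0)$ with $w^0_{\ker}\in\mathcal V_{\ker}$. Let $u$ be the solution of $$\ddot u(t)+\mathcal D\dot u(t)+\mathcal A u(t)+\mathcal B^*\lambda(t)=f(t,u)\ \text{ in }\mathcal V^*,\qquad \mathcal B u(t)=g(t)\ \text{ in }\mathcal Q^*,\qquad u(0)=u^0,\ \dot u(0)=w^0,$$ and assume $$u\in C^3([0,T],\mathcal V)\cap C^4([0,T],\mathcal H),\qquad f(\cdot,u(\cdot))\in C^2([0,T],\mathcal H),\qquad g\in C^4([0,T],\mathcal Q^* ).$$ Then the implicit--explicit scheme defined in the context, started from $(u^0,w^0)$ with constant step size $\tau=T/N$ and time points $t_n=n\tau$, is convergent of second order: there is a constant $C>0$ independent of $\tau$ and $n$ such that $$\|u(t_n)-u^n\|_{\mathcal V}+\|\dot u(t_n)-w^n\|_{\mathcal H}\le C\,\tau^2 .$$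
   Context: **Spaces.** $\mathcal V,\mathcal H,\mathcal Q$ are Hilbert spaces with duals $\mathcal V^*,\mathcal H^*,\mathcal Q^*$; $\mathcal V\hookrightarrow\mathcal H\cong\mathcal H^*\hookrightarrow\mathcal V^*$ is a Gelfand triple (continuous dense embeddings). **Constraint operator.** $\mathcal B\colon\mathcal V\to\mathcal Q^*$ is linear and continuous, and there is $\beta>0$ with $\inf_{q\in\mathcal Q\setminus\{0\}}\sup_{v\in\mathcal V\setminus\{0\}}\frac{\langle\mathcal Bv,q\rangle}{\|v\|_{\mathcal V}\|q\|_{\mathcal Q}}\ge\beta$. Set $\mathcal V_{\ker}=\ker\mathcal B$ and let $\mathcal H_{\ker}$ be the closure of $\mathcal V_{\ker}$ in $\mathcal H$. **Differential operator.** $\mathcal A\colon\mathcal V\to\mathcal V^*$ is linear, continuous and elliptic on $\mathcal V_{\ker}$. Moreover $\mathcal A=\mathcal A_1+\mathcal A_2$ with $\mathcal A_1$ self-adjoint ($\langle\mathcal A_1u,v\rangle=\langle u,\mathcal A_1v\rangle$) and elliptic on $\mathcal V_{\ker}$, and $\mathcal A_2\in\mathcal L(\mathcal V,\mathcal H^* )$. $\mathcal A_{\ker}=\mathcal A|_{\mathcal V_{\ker}}\colon\mathcal V_{\ker}\to\mathcal V_{\ker}^*$ (functionals in $\mathcal V^*$ are restricted to $\mathcal V_{\ker}$); its domain is understood as an operator in $\mathcal H_{\ker}$, i.e. those $v\in\mathcal V_{\ker}$ with $\mathcal A_{\ker}v\in\mathcal H_{\ker}^*\cong\mathcal H_{\ker}$.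 **Complement and right inverse.** $\mathcal V_{\rm c}=\{v\in\mathcal V:\langle\mathcal Av,w\rangle=0\ \forall w\in\mathcal V_{\ker}\}$, so $\mathcal V=\mathcal V_{\ker}\oplus\mathcal V_{\rm c}$; $\mathcal B^-\colon\mathcal Q^*\to\mathcal V$ is the continuous right inverse of $\mathcal B$ with image $\mathcal V_{\rm c}$. **Damping operator.** $\mathcal D\colon\mathcal H\to\mathcal V^*$ is linear and continuous; its restriction $\mathcal D|_{\mathcal V}\colon\mathcal V\to\mathcal H^*$ is continuous, and $(\mathcal Du,u)_{\mathcal H}\ge0$ for all $u\in\mathcal V$. **Nonlinearity.** $f\colon[0,T]\times\mathcal H\to\mathcal H^*$. Local Lipschitz condition: for each $\rho$ there is $L_{\mathcal V}(\rho)$ such that $\|f(t,v_1)-f(t,v_2)\|_{\mathcal H^*}\le L_{\mathcal V}(\rho)\|v_1-v_2\|_{\mathcal V}$ for all $t$ and all $v_1,v_2\in\mathcal V$ with $\|v_i\|_{\mathcal V}\le\rho$. **Scheme.** Write $g^s=g(s\tau)$ for integers and half-integers $s$, and $f^n=f(t_n,u^n)$. Given $(u^n,w^n)$, step $n\to n+1$ consists of: 1. find $(w^{n+1/2},\lambda^{n+1})\in\mathcal V\times\mathcal Q$ with $(\mathrm{id}+\tfrac\tau2\mathcal D+\tfrac{\tau^2}{4}\mathcal A)w^{n+1/2}+\tfrac\tau2\mathcal B^*\lambda^{n+1}=w^n-\tfrac\tau2\mathcal Au^n+\tfrac\tau2f^n$ in $\mathcal V^*$ and $\mathcal Bw^{n+1/2}=\tfrac1\tau(g^{n+1}-g^n)$;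 2. $u^{n+1}=u^n+\tau w^{n+1/2}$; 3. find $w^{n+1}\in\mathcal H_{\ker}+\mathcal V_{\rm c}$ and $\mu^{n+1}$ with $w^{n+1}+\mathcal B^*\mu^{n+1}=2w^{n+1/2}-w^n+\tfrac\tau2(f^{n+1}-f^n)$ and $\mathcal Bw^{n+1}=\tfrac1\tau(g^{n+3/2}-g^{n+1/2})$. It is a standing assumption that the system in step 3 is uniquely solvable (in the paper this is discussed for $\mathcal H_{\ker}$ a proper subspace of $\mathcal H$), where the constraint on $w^{n+1}$ means that its $\mathcal V_{\rm c}$-component is $\tfrac1\tau\mathcal B^-(g^{n+3/2}-g^{n+1/2})$. Where step 3 evaluates $g$ slightly beyond $T$ (last step), $g$ is a fixed $C^4$ extension to a larger interval. *)

(* Defs.v *)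
From HB Require Import structures.
From mathcomp Require Import all_boot all_order all_algebra.
From mathcomp Require Import all_classical all_reals all_analysis.
From mathcomp Require Import ring.
Set Implicit Arguments.
Unset Strict Implicit.
Unset Printing Implicit Defensive.
Import Order.TTheory GRing.Theory Num.Theory.
Import numFieldNormedType.Exports.
Local Open Scope classical_set_scope.
Local Open Scope ring_scope.

Section ContinuousLinearMaps.
Context {R : realType} {X Y : normedModType R}.

Definition clin_pred : {pred X -> Y} :=
  fun f => `[< linear f /\ continuous f >].

Record clin : Type := Clin {
  clin_fun :> X -> Y;
  clin_funP : clin_fun \in clin_pred }.

HB.instance Definition _ := [isSub for clin_fun].
HB.instance Definition _ := gen_eqMixin clin.
HB.instance Definition _ := gen_choiceMixin clin.

Lemma clin_submod_closed : submod_closed clin_pred.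
Proof.
split=> [|a f g].
  apply/asboolP; split=> [b x y|x]; last exact: cvg_cst.
  by have E z : (0 : X -> Y) z = 0 by []; rewrite !E scaler0 addr0.
move=> /asboolP[fl fc] /asboolP[gl gc].
have E z : (a *: f + g) z = a *: f z + g z by [].
apply/asboolP; split=> [b x y|x].
  by rewrite !E fl gl !scalerDr !scalerA (mulrC a b) addrACA.
by apply: cvgD; [apply: cvgZr; exact: fc | exact: gc].
Qed.

HB.instance Definition _ :=
  GRing.isSubmodClosed.Build R (X -> Y) clin_pred clin_submod_closed.
HB.instance Definition _ := [SubChoice_isSubLmodule of clin by <:].

Lemma clin_linear (f : clin) : linear f.
Proof. by have /asboolP[] := clin_funP f. Qed.

Lemma clin_continuous (f : clin) : continuous f.
Proof. by have /asboolP[] := clin_funP f. Qed.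

HB.instance Definition _ (f : clin) :=
  GRing.isLinear.Build R X Y *:%R f (@clin_linear f).

Lemma clinP (f g : clin) : f =1 g -> f = g.
Proof. by move=> fg; apply/val_inj/funext. Qed.

Lemma clinD (f g : clin) x : (f + g) x = f x + g x. Proof. by []. Qed.
Lemma clinZ a (f : clin) x : (a *: f) x = a *: f x. Proof. by []. Qed.
Lemma clin0 x : (0 : clin) x = 0. Proof. by []. Qed.

Definition clin_norm (f : clin) : R :=
  sup [set `|f x| | x in [set x | `|x| <= 1]].

Lemma clin_has_sup (f : clin) :
  has_sup [set `|f x| | x in [set x | `|x| <= 1]].
Proof.
split; first by exists `|f 0|, 0 => //=; rewrite normr0.
have /linear_boundedP/pinfty_ex_gt0[M M0 fM] :=
  continuous_linear_bounded (0 : X) (@clin_continuous f 0).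
exists M => _ [x /= x1 <-]; apply: le_trans (fM x) _.
by rewrite ler_piMr // ltW.
Qed.

Lemma clin_norm_ge0 (f : clin) : 0 <= clin_norm f.
Proof.
apply: (le_trans (normr_ge0 (f 0))).
apply: sup_upper_bound; first exact: clin_has_sup.
by exists 0 => //=; rewrite normr0.
Qed.

Lemma clin_norm_le (f : clin) x : `|f x| <= clin_norm f * `|x|.
Proof.
have [->|x0] := eqVneq x 0; first by rewrite linear0 !normr0 mulr0.
have nx : 0 < `|x| by rewrite normr_gt0.
rewrite -ler_pdivrMr //.
have -> : `|f x| / `|x| = `|f (`|x|^-1 *: x)|.
  by rewrite linearZ normrZ gtr0_norm ?invr_gt0 // mulrC.
apply: sup_upper_bound; first exact: clin_has_sup.
exists (`|x|^-1 *: x) => //=.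
by rewrite normrZ gtr0_norm ?invr_gt0 // mulVf // gt_eqF.
Qed.

Lemma clin_norm_lub (f : clin) M :
  0 <= M -> (forall x, `|f x| <= M * `|x|) -> clin_norm f <= M.
Proof.
move=> M0 fM; apply: ge_sup; first by case: (clin_has_sup f).
by move=> _ [x /= x1 <-]; apply: le_trans (fM x) _; rewrite ler_piMr.
Qed.

Lemma clin_normD (f g : clin) : clin_norm (f + g) <= clin_norm f + clin_norm g.
Proof.
apply: clin_norm_lub; first by rewrite addr_ge0 ?clin_norm_ge0.
move=> x; rewrite clinD mulrDl; apply: le_trans (ler_normD _ _) _.
by rewrite lerD ?clin_norm_le.
Qed.

Lemma clin_normZle a (f : clin) : clin_norm (a *: f) <= `|a| * clin_norm f.
Proof.
apply: clin_norm_lub; first by rewrite mulr_ge0 ?clin_norm_ge0.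
by move=> x; rewrite clinZ normrZ -mulrA ler_wpM2l ?clin_norm_le.
Qed.

Lemma clin_normZ a (f : clin) : clin_norm (a *: f) = `|a| * clin_norm f.
Proof.
apply/eqP; rewrite eq_le clin_normZle /=.
have [->|a0] := eqVneq a 0; first by rewrite normr0 mul0r clin_norm_ge0.
rewrite -ler_pdivlMl ?normr_gt0 // -normfV.
by apply: le_trans (clin_normZle _ _); rewrite scalerA mulVf // scale1r.
Qed.

Lemma clin_norm0_eq0 (f : clin) : clin_norm f = 0 -> f = 0.
Proof.
move=> f0; apply: clinP => x; apply/eqP; rewrite clin0 -normr_le0.
by have := clin_norm_le f x; rewrite f0 mul0r.
Qed.

HB.instance Definition _ := Lmodule_isNormed.Build R clin
  clin_normD clin_normZ clin_norm0_eq0.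

Lemma clin_bounded_pred (f : X -> Y) (M : R) :
  linear f -> (forall x, `|f x| <= M * `|x|) -> f \in clin_pred.
Proof.
move=> fl fM; apply/asboolP; split=> //.
pose fL := HB.pack_for {linear X -> Y} f (GRing.isLinear.Build R X Y *:%R f fl).
apply: (@bounded_linear_continuous _ _ _ fL); apply/linear_boundedP.
near=> r => x; apply: le_trans (fM x) _; rewrite ler_wpM2r //.
Unshelve. all: by end_near. Qed.

End ContinuousLinearMaps.
Arguments clin {R} X Y.

Lemma clin_normE {R : realType} (X Y : normedModType R) (f : clin X Y) :
  `|f| = clin_norm f.
Proof. by []. Qed.

Definition dual {R : realType} (X : normedModType R) := clin X R^o.

Section ClinOperations.
Context {R : realType} {X Y Z : normedModType R}.

Lemma clin_comp_subproof (f : clin Y Z) (g : clin X Y) :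
  (f : Y -> Z) \o g \in @clin_pred R X Z.
Proof.
apply: (@clin_bounded_pred _ _ _ _ (clin_norm f * clin_norm g)) => [a x y|x].
  by rewrite /= !linearP.
apply: le_trans (clin_norm_le f (g x)) _.
by rewrite -mulrA ler_wpM2l ?clin_norm_ge0 ?clin_norm_le.
Qed.

(* For [f : dual Y] this is the restriction (pull-back) of [f] along [g]. *)
Definition clin_comp (f : clin Y Z) (g : clin X Y) : clin X Z :=
  Clin (clin_comp_subproof f g).

Lemma adjoint_subproof (B : clin X (dual Y)) (q : Y) :
  (fun v => B v q : R^o) \in @clin_pred R X R^o.
Proof.
apply: (@clin_bounded_pred _ _ _ _ (clin_norm B * `|q|)) => [a x y|x].
  by rewrite linearP.
rewrite mulrAC; apply: le_trans (clin_norm_le (B x) q) _.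
by rewrite ler_wpM2r //; exact: (@clin_norm_le _ X (dual Y)).
Qed.

Definition adjoint (B : clin X (dual Y)) (q : Y) : dual X :=
  Clin (adjoint_subproof B q).

End ClinOperations.

HB.mixin Record isHilbert (R : realType) V & CompleteNormedModule R V := {
  hdot : V -> V -> R;
  hdotC : forall x y, hdot x y = hdot y x;
  hdotPl : forall a x y z, hdot (a *: x + y) z = a * hdot x z + hdot y z;
  hdot_norm : forall x, hdot x x = `|x| ^+ 2 }.

#[short(type="hilbertType")]
HB.structure Definition Hilbert (R : realType) :=
  {V of CompleteNormedModule R V & isHilbert R V}.

Section Riesz.
Context {R : realType} {H : hilbertType R}.

Lemma hdotPr (x : H) a y z : hdot x (a *: y + z) = a * hdot x y + hdot x z.
Proof. by rewrite hdotC hdotPl ![hdot _ x]hdotC. Qed.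

Lemma cauchy_schwarz (x y : H) : `|hdot x y| <= `|x| * `|y|.
Proof.
have [->|y0] := eqVneq y 0.
  have := hdotPr x (-1) 0 0; rewrite scaler0 addr0 mulN1r addNr => ->.
  by rewrite !normr0 mulr0.
have ny : 0 < `|y| by rewrite normr_gt0.
rewrite -ler_sqr ?nnegrE ?mulr_ge0 // real_normK ?num_real // exprMn.
pose c := - (hdot x y / `|y| ^+ 2).
have : 0 <= hdot (c *: y + x) (c *: y + x) by rewrite hdot_norm sqr_ge0.
rewrite hdotPl !hdotPr !hdot_norm (hdotC y x) /c.
have ny2 : 0 < `|y| ^+ 2 by rewrite exprn_gt0.
move=> h; rewrite -subr_ge0 -(pmulr_lge0 _ (_ : 0 < (`|y| ^+ 2)^-1)) ?invr_gt0 //.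
apply: le_trans h _; rewrite le_eqVlt; apply/orP; left; apply/eqP.
move: (`|y| ^+ 2) ny2 => p p0; move: (`|x| ^+ 2) (hdot x y) => s t.
by field; rewrite gt_eqF.
Qed.

Lemma riesz_subproof (h : H) : (hdot h : H -> R^o) \in @clin_pred R H R^o.
Proof.
apply: (@clin_bounded_pred _ _ _ _ `|h|) => [a x y|x]; first exact: hdotPr.
exact: cauchy_schwarz.
Qed.

Definition riesz (h : H) : dual H := Clin (riesz_subproof h).

End Riesz.

Section TimeRegularity.
Context {R : realType} {X : normedModType R}.
Implicit Types (D : set R) (h : R -> X).

(* Difference quotients are taken inside D: at the endpoints of a compact
   interval the derivative is one-sided. *)
Definition diff_quot_within D h (t : R) : set_system X :=
  (fun s => (s - t)^-1 *: (h s - h t)) @ within D t^'.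

Definition derive_within D h (t : R) : X := lim (diff_quot_within D h t).

Fixpoint Ck_on (k : nat) D h : Prop :=
  match k with
  | 0 => {within D, continuous h}
  | k'.+1 => (forall t, D t -> cvg (diff_quot_within D h t)) /\
             Ck_on k' D (derive_within D h)
  end.

(* Bochner measurability: an almost everywhere limit of simple functions. *)
Definition strongly_measurable_on D h : Prop :=
  exists s : nat -> R -> X,
    (forall n, finite_set (s n @` D) /\
               forall x, measurable (D `&` s n @^-1` [set x])) /\
    {ae (@lebesgue_measure R), forall t, D t -> s n t @[n --> \oo] --> h t}.

End TimeRegularity.

Definition caratheodory {R : realType} {X Y : normedModType R} (D : set R)
    (f : R -> X -> Y) : Prop :=
  (forall x, strongly_measurable_on D (f^~ x)) /\
  {ae (@lebesgue_measure R), forall t, D t -> continuous (f t)}.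

Section ConstrainedSystem.
Context {R : realType} {V H Q : hilbertType R}.
Variables (iota : clin V H) (A : clin V (dual V)) (B : clin V (dual Q)).

Definition gelfand_embedding : Prop := injective iota /\ dense (range iota).

(* h in H as an element of V^*, through H = H^*. *)
Definition to_dual (h : H) : dual V := clin_comp (riesz h) iota.

(* Elements of H^* as elements of V^*. *)
Definition restr (phi : dual H) : dual V := clin_comp phi iota.

Definition Vker : set V := [set v | B v = 0].

Definition Hker : set H := closure (iota @` Vker).

Definition Vc : set V := [set v | forall w, Vker w -> A v w = 0].

(* Extended reals, so that the infimum over the nonzero elements of a trivial
   Q is +oo. *)
Definition inf_sup_ge (beta : R) : Prop :=
  (beta%:E <= ereal_inf
    [set ereal_sup [set (B v q / (`|v| * `|q|))%:E | v in [set v | v != 0%R]]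
      | q in [set q | q != 0%R]])%E.

Definition elliptic_on_Vker (A' : clin V (dual V)) : Prop :=
  exists2 alpha : R, 0 < alpha &
    forall v, Vker v -> alpha * `|v| ^+ 2 <= A' v v.

(* The domain of A_ker as an unbounded operator in Hker. *)
Definition dom_Aker : set V :=
  [set v | Vker v /\
    exists2 h, Hker h & forall w, Vker w -> A v w = hdot h (iota w)].

Definition is_right_inverse_onto_Vc (Bm : clin (dual Q) V) : Prop :=
  cancel Bm B /\ range Bm = Vc.

Variable (D : clin H (dual V)) (Bm : clin (dual Q) V).

(* Since w only lies in Hker + Vc, the constraint B w = eta means that the
   Vc-component of w is Bm eta. *)
Definition projection_system (r : dual H) (eta : dual Q) (w : H) (mu : Q) :=
  (exists2 h, Hker h & w = h + iota (Bm eta)) /\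
  to_dual w + adjoint B mu = restr r.

Definition projection_uniquely_solvable : Prop :=
  forall r eta, exists! p : H * Q, projection_system r eta p.1 p.2.

Variables (f : R -> H -> dual H) (g : R -> dual Q).

Section Step.
Variables (tau : R) (n : nat) (u u' : V) (w w' : H).

Let tn : R := n%:R * tau.
Let tn1 : R := n.+1%:R * tau.
Let fn := f tn (iota u).
Let fn1 := f tn1 (iota u').

Definition imex_step : Prop :=
  exists (wh : V) (lambda mu : Q),
  [/\ to_dual (iota wh) + (tau / 2) *: D (iota wh) + (tau ^+ 2 / 4) *: A wh
        + (tau / 2) *: adjoint B lambda
        = to_dual w - (tau / 2) *: A u + (tau / 2) *: restr fn,
      B wh = tau^-1 *: (g tn1 - g tn),
      u' = u + tau *: wh
    & projection_system
        (riesz (2 *: iota wh - w) + (tau / 2) *: (fn1 - fn))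
        (tau^-1 *: (g ((n%:R + 3 / 2) * tau) - g ((n%:R + 1 / 2) * tau)))
        w' mu].

End Step.

Definition imex_scheme (tau : R) (N : nat) (u0 : V) (w0 : H)
    (u : nat -> V) (w : nat -> H) : Prop :=
  [/\ u 0%N = u0, w 0%N = w0 &
      forall n, (n < N)%N -> imex_step tau n (u n) (u n.+1) (w n) (w n.+1)].

(* The multiplier is determined by u; no regularity is required of it. *)
Definition pdae_solution (T : R) (u0 w0 : V) (u : R -> V) (lambda : R -> Q) :=
  let u_t := derive_within `[0, T] u in
  let u_tt := derive_within `[0, T] u_t in
  [/\ u 0 = u0, u_t 0 = w0 &
      forall t, t \in `[0, T] ->
        to_dual (iota (u_tt t)) + D (iota (u_t t)) + A (u t)
          + adjoint B (lambda t) = restr (f t (iota (u t))) /\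
        B (u t) = g t].

End ConstrainedSystem.

(* Main.v *)
Require Import Defs.
From HB Require Import structures.
From mathcomp Require Import all_boot all_order all_algebra.
From mathcomp Require Import all_classical all_reals all_analysis.
From mathcomp Require Import ring lra.
Set Implicit Arguments.
Unset Strict Implicit.
Unset Printing Implicit Defensive.
Import Order.TTheory GRing.Theory Num.Theory.
Import numFieldNormedType.Exports.
Local Open Scope classical_set_scope.
Local Open Scope ring_scope.

(**
  Write [e_n = u(t_n) - u^n], which lies in [ker B], and let [eta] be the error
  of the half-step velocity [w^(n+1/2)] against the difference quotient of [u], so
  that [e_(n+1) = e_n + tau eta].  Tested on [ker B] the multipliers disappear, and
  eliminating [w^(n+1/2)] turns the scheme into a Crank-Nicolson step together
  with a relation saying that [w^n + w^(n+1)] is close to [2 w^(n+1/2)].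

  The latter relation has a defect [O(tau^2)], one order too low for a direct
  energy estimate.  Its leading part is [tau^2 (psi(t_n) + psi(t_(n+1)))] with
  [psi = u'''/12 - (d/dt) f(., u)/4], so one works instead with [s_n], the
  projection to [H_ker] of [u'(t_n) - w^n - tau^2 psi(t_n)]; the projection exists
  because the system of the third substep is solvable.  Testing the two error
  equations with [eta] and [s_(n+1) - s_n] yields for [E_n = |s_n|^2 + <A1 e_n, e_n>]
  the bound [E_(n+1) - E_n <= C tau (E_n + E_(n+1) + tau^4)], and Gronwall gives
  [E_n = O(tau^4)].

  The local Lipschitz constant at [u^(n+1)] requires an a priori bound of
  [u^(n+1)]; it follows from the linearly implicit half step, in which only [f^n]
  occurs, as soon as [tau] is small.  The finitely many remaining step sizes are
  harmless because the numerical solution is unique.  Finally, what [w^n] misses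
  outside [H_ker] is the midpoint-rule error of [B^- g'], which is [O(tau^2)].
*)

(** * Calculus on a compact interval *)

Section ClinArith.
Context {R : realType} {X Y : normedModType R}.
Implicit Type L : clin X Y.

Lemma clin_argD L x y : L (x + y) = L x + L y.
Proof. exact: linearD. Qed.

Lemma clin_argN L x : L (- x) = - L x.
Proof. exact: linearN. Qed.

Lemma clin_argB L x y : L (x - y) = L x - L y.
Proof. exact: linearB. Qed.

Lemma clin_argZ L a x : L (a *: x) = a *: L x.
Proof. exact: linearZZ. Qed.

Lemma clin_arg0 L : L 0 = 0.
Proof. exact: linear0. Qed.

Lemma clin_arg_sum L n (x : 'I_n -> X) : L (\sum_(i < n) x i) = \sum_(i < n) L (x i).
Proof. exact: linear_sum. Qed.

Lemma clinN L x : (- L) x = - L x.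
Proof. by []. Qed.

Lemma clinB L1 L2 x : (L1 - L2) x = L1 x - L2 x.
Proof. by []. Qed.

Lemma clin_le L x : `|L x| <= `|L| * `|x|.
Proof. exact: clin_norm_le. Qed.

End ClinArith.

Section CalculusOnInterval.
Context {R : realType}.

(** Properness makes limits of one-sided difference quotients unique. From [t] one can move by up to
    [S / 2] to the right or to the left without leaving the interval. *)
Lemma within_itv_dnbhs_proper (S t : R) : 0 < S -> `[0, S]%classic t ->
  ProperFilter (within `[0, S] t^').
Proof.
move=> S0 /=; rewrite in_itv/= => /andP[t0 tS].
apply: Build_ProperFilter_ex => P; rewrite /within /= => /nbhs_ballP[e /= e0 eP].
pose d := Num.min (e / 2) (S / 2).
have d0 : 0 < d by rewrite lt_min !divr_gt0.
have [de dS] : d < e /\ d <= S / 2.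
  by split; rewrite gt_min || rewrite ge_min ?lexx ?orbT //; apply/orP; left; lra.
have [tS2|tS2] := leP t (S / 2).
  exists (t + d); apply: eP; rewrite /ball/= ?in_itv/=.
  - by rewrite opprD addrA subrr add0r normrN gtr0_norm.
  - by rewrite -subr_eq0 addrAC subrr add0r gt_eqF.
  - by apply/andP; split; lra.
exists (t - d); apply: eP; rewrite /ball/= ?in_itv/=.
- by rewrite opprB addrC subrK gtr0_norm.
- by rewrite -subr_eq0 addrAC subrr add0r oppr_eq0 gt_eqF.
- by apply/andP; split; lra.
Qed.

Lemma diff_quot_clin (X Y : normedModType R) (L : clin X Y) (D : set R)
    (h : R -> X) t l :
  diff_quot_within D h t --> l -> diff_quot_within D (L \o h) t --> L l.
Proof.
move=> hl.
rewrite /diff_quot_within.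
have -> : (fun s => (s - t)^-1 *: ((L \o h) s - (L \o h) t)) =
    L \o (fun s => (s - t)^-1 *: (h s - h t)).
  by apply/funext => s /=; rewrite clin_argZ clin_argB.
exact: (cvg_comp _ _ hl (@clin_continuous _ _ _ L l)).
Qed.

Lemma derive_within_clin (X Y : normedModType R) (L : clin X Y) (S : R)
    (h : R -> X) t : 0 < S -> `[0, S]%classic t ->
  cvg (diff_quot_within `[0, S] h t) ->
  derive_within `[0, S] (L \o h) t = L (derive_within `[0, S] h t).
Proof.
move=> S0 tS hc; have ? := within_itv_dnbhs_proper S0 tS.
exact: (cvg_lim (@norm_hausdorff _ _) (diff_quot_clin hc)).
Qed.

Lemma eq_diff_quot_within (X : normedModType R) (D : set R) (h1 h2 : R -> X) t :
  D t -> (forall s, D s -> h1 s = h2 s) ->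
  diff_quot_within D h1 t = diff_quot_within D h2 t.
Proof.
move=> Dt h12; rewrite /diff_quot_within.
apply/seteqP; split=> P /=; rewrite /fmap /= /within /=;
  by apply: (@filterS _ t^') => s + Ds => /(_ Ds);
    rewrite /preimage /= (h12 s Ds) (h12 t Dt).
Qed.

Lemma diff_quot_within_continuous (X : normedModType R) (D : set R)
    (h : R -> X) : (forall t, D t -> cvg (diff_quot_within D h t)) ->
  {within D, continuous h}.
Proof.
move=> hc; apply/subspace_continuousP => t Dt.
have hq := hc t Dt.
have FF : Filter (within D t^') by exact: within_filter.
have h1 : (fun s => (s - t) *: ((s - t)^-1 *: (h s - h t)) + h t)
    @ within D t^' --> 0 *: lim (diff_quot_within D h t) + h t.
  apply: cvgD; last exact: cvg_cst.
  apply: cvgZ; last exact: hq.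
  rewrite -(subrr t); apply: cvgB; last exact: cvg_cst.
  by move=> P /= tP; apply: cvg_within; apply: cvg_within.
rewrite scale0r add0r in h1.
move=> P /= hP; have := h1 P hP; rewrite /fmap /= /within /=.
apply: (@filterS _ (nbhs t)) => s + Ds; have [->|st] := eqVneq s t.
  by move=> _; exact: (nbhs_singleton hP).
by move=> /(_ isT Ds); rewrite /preimage /= scalerA divff ?subr_eq0// scale1r subrK.
Qed.

(** Closer than [min t (S - t)] to an interior point the restriction to the interval is void, so the
    translated quotient is the ordinary one. This gives access to the mean value theorem. *)
Lemma is_derive_diff_quot (S : R) (phi : R -> R^o) t l : 0 < t < S ->
  diff_quot_within `[0, S] phi t --> l -> is_derive t 1 phi l.
Proof.
move=> /andP[t0 tS] hl.
have hc : (fun h => h^-1 *: (phi (h *: 1 + t) - phi t)) @ 0^' --> l.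
  have sc : (fun h : R => h + t) @ 0^' --> within `[0, S] t^'.
    move=> P; rewrite /within/= => /nbhs_ballP[e /= e0 eP].
    apply/nbhs_ballP; exists (Num.min e (Num.min t (S - t))) => /=.
      by rewrite !lt_min e0 t0/= subr_gt0.
    move=> h; rewrite /ball/= sub0r normrN !lt_min => /and3P[he ht hS] h0.
    apply: eP; first by rewrite /ball/= opprD addrCA subrr addr0 normrN.
      by rewrite -subr_eq0 addrK.
    rewrite in_itv/=; move: ht hS; rewrite !ltr_norml => /andP[? _] /andP[_ ?].
    by apply/andP; split; lra.
  have := cvg_comp _ _ sc hl.
  have -> // : (fun h => h^-1 *: (phi (h *: 1 + t) - phi t)) =
    (fun s => (s - t)^-1 *: (phi s - phi t)) \o (fun h => h + t).
  by apply/funext => h /=; rewrite addrK [h *: _]mulr1.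
by apply: DeriveDef; [apply/cvg_ex; exists l|exact: cvg_lim].
Qed.

End CalculusOnInterval.

(** * Taylor remainders *)

Section TaylorBound.
Context {R : realType}.

(** Induction on [k] by the mean value theorem: the derivative of the remainder is the remainder of
    the family shifted by one. The factor [1 / k!] of the sharp bound is given up. *)
Lemma taylor_le_scalar (a b M : R) (phi : nat -> R -> R) k : a <= b ->
  (forall j t, (j < k)%N -> t \in `]a, b[ -> is_derive t 1 (phi j) (phi j.+1 t)) ->
  (forall j, (j < k)%N -> {within `[a, b], continuous phi j}) ->
  (forall t, t \in `[a, b] -> `|phi k t| <= M) ->
  `|phi 0%N b - \sum_(j < k) phi j a / j`!%:R * (b - a) ^+ j| <= M * (b - a) ^+ k.
Proof.
elim: k b phi => [|k IHk] b phi ab dphi cphi bphi.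
  by rewrite big_ord0 subr0 expr0 mulr1 bphi// in_itv/= ab lexx.
(* As a formal polynomial, the Taylor polynomial can be differentiated algebraically in [dP]. *)
pose P m (c : nat -> R) : {poly R} :=
  \sum_(j < m) (c j / j`!%:R) *: ('X - a%:P) ^+ j.
have PE m c t : (P m c).[t] = \sum_(j < m) c j / j`!%:R * (t - a) ^+ j.
  by rewrite horner_sum; apply: eq_bigr => j _; rewrite !hornerE.
have dP m c : (P m.+1 c)^`() = P m (fun j => c j.+1).
  rewrite /P big_ord_recl derivD expr0 derivZ derivC scaler0 add0r linear_sum /=.
  apply: eq_bigr => j _; rewrite derivZ deriv_exp derivXsubC mul1r /= add0n.
  rewrite -[_ ^+ j *+ _]scaler_nat scalerA; congr (_ *: _).
  rewrite /bump/= add1n factS natrM invfM; field.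
  by rewrite nat1r !pnatr_eq0 -lt0n fact_gt0.
pose r t := phi 0%N t - (P k.+1 (phi ^~ a)).[t].
have ra : r a = 0.
  rewrite /r PE big_ord_recl /= fact0 divr1 expr0 mulr1 big1 ?addr0 ?subrr// => j _.
  by rewrite expr0n mulr0.
have [<-|ab'] := eqVneq a b.
  have := ra; rewrite /r PE => ->.
  by rewrite normr0 subrr expr0n mulr0.
have {}ab' : a < b by rewrite lt_neqAle ab' ab.
have [] := @MVT _ r (fun t => phi 1%N t - (P k (fun j => phi j.+1 a)).[t]) a b ab'.
- move=> t tab; rewrite /= -(dP k (phi ^~ a)); apply: is_deriveB; first exact: dphi.
- apply: within_continuousB; first exact: cphi.
  exact: continuous_subspaceT (@continuous_horner _ _).
move=> c /[dup]; rewrite {1}in_itv/= => /andP[ac cb] cab.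
rewrite ra subr0 {1}/r PE => ->; rewrite normrM PE exprSr mulrA.
have ba0 : 0 <= b - a by rewrite subr_ge0.
rewrite (ger0_norm ba0) ler_wpM2r//.
have M0 : 0 <= M.
  by apply: le_trans (normr_ge0 (phi k.+1 a)) (bphi _ _); rewrite in_itv/= lexx.
apply: (@le_trans _ _ (M * (c - a) ^+ k)); last first.
  by rewrite ler_wpM2l// lerXn2r ?nnegrE ?subr_ge0 ?(ltW ac)// lerD2r ltW.
apply: (IHk c (fun j => phi j.+1)); first exact: ltW.
- move=> j t jk; rewrite in_itv/= => /andP[t0 t1]; apply: dphi => //.
  by rewrite in_itv/= t0 (lt_trans t1 cb).
- move=> j jk; apply: continuous_subspaceW (cphi j.+1 jk).
  by move=> t/=; rewrite !in_itv/= => /andP[-> tc]; rewrite (le_trans tc (ltW cb)).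
- move=> t; rewrite in_itv/= => /andP[t0 t1]; apply: bphi.
  by rewrite in_itv/= t0 (le_trans t1 (ltW cb)).
Qed.

(** Testing the remainder [x] with itself reduces to the scalar case: [hdot x x] is the Taylor
    remainder of [hdot x (h 0 t)], whose last derivative is at most [|x| M]. Then divide by
    [|x|]. *)
Lemma taylor_le (X : hilbertType R) (S M : R) (h : nat -> R -> X) k :
  (forall j t, (j < k)%N -> `[0, S]%classic t ->
    diff_quot_within `[0, S] (h j) t --> h j.+1 t) ->
  (forall t, `[0, S]%classic t -> `|h k t| <= M) ->
  forall s b, 0 <= s -> s <= b -> b <= S ->
  `|h 0%N b - \sum_(j < k) ((b - s) ^+ j / j`!%:R) *: h j s| <= M * (b - s) ^+ k.
Proof.
move=> dh bh s b s0 sb bS; set x := (X in `|X|).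
have [->|x0] := eqVneq x 0.
  rewrite normr0 mulr_ge0 ?exprn_ge0 ?subr_ge0//.
  by apply: le_trans (normr_ge0 (h k s)) (bh _ _) => /=;
    rewrite in_itv/= s0 (le_trans sb).
have nx : 0 < `|x| by rewrite normr_gt0.
rewrite -(ler_pM2l nx) -expr2 -hdot_norm.
have -> : hdot x x = `|riesz x (h 0%N b) -
    \sum_(j < k) riesz x (h j s) / j`!%:R * (b - s) ^+ j|.
  rewrite -[hdot x x]ger0_norm ?hdot_norm ?sqr_ge0// -hdot_norm; congr (`|_|).
  rewrite -[hdot x x]/(riesz x x) {2}/x clin_argB; congr (_ - _).
  rewrite clin_arg_sum; apply: eq_bigr => j _.
  by rewrite clin_argZ -[_ *: _]/(_ * _ :> R); field; rewrite pnatr_eq0 -lt0n fact_gt0.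
rewrite mulrA.
apply: (@taylor_le_scalar s b (`|x| * M) (fun j t => riesz x (h j t))) => //.
- move=> j t jk; rewrite in_itv/= => /andP[st tb].
  apply: (@is_derive_diff_quot _ S); first by
    rewrite (le_lt_trans s0 st) (lt_le_trans tb).
  apply: (diff_quot_clin (L := riesz x)); apply: dh => //=.
  by rewrite in_itv/= (le_trans s0 (ltW st)) (le_trans (ltW tb) bS).
- move=> j jk; apply: (@continuous_subspaceW _ _ `[s, b] `[0, S]).
    move=> t/=; rewrite !in_itv/= => /andP[st tb].
    by rewrite (le_trans s0 st) (le_trans tb bS).
  apply: (@diff_quot_within_continuous _ (R^o : normedModType R)) => t St.
  apply/cvg_ex; exists (riesz x (h j.+1 t)).
  by apply: (diff_quot_clin (L := riesz x)); apply: dh.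
- move=> t; rewrite in_itv/= => /andP[st tb].
  apply: le_trans (cauchy_schwarz _ _) _; rewrite ler_wpM2l//; apply: bh => /=.
  by rewrite in_itv/= (le_trans s0 st) (le_trans tb bS).
Qed.

Lemma Ck_on_diff_quot (X : normedModType R) k (D : set R) (h : R -> X) :
  Ck_on k D h -> forall j t, (j < k)%N -> D t ->
  diff_quot_within D (iter j (derive_within D) h) t -->
    iter j.+1 (derive_within D) h t.
Proof.
elim: k h => [//|k IHk] h /= [hc hk] [|j] t jk Dt; first exact: hc.
by have := IHk _ hk j t jk Dt; rewrite -!iterSr.
Qed.

Lemma Ck_on_continuous (X : normedModType R) k (D : set R) (h : R -> X) :
  Ck_on k D h -> {within D, continuous iter k (derive_within D) h}.
Proof.
by elim: k h => [//|k IHk] h /= [_ /IHk]; rewrite -iterSr.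
Qed.

Lemma Ck_onW (X : normedModType R) k (D : set R) (h : R -> X) :
  Ck_on k.+1 D h -> Ck_on k D h.
Proof.
elim: k h => [|k IHk] h [hc hk]; first exact: diff_quot_within_continuous.
by split=> //; exact: IHk.
Qed.

Lemma Ck_on_bounded (X : normedModType R) k (S : R) (h : R -> X) :
  0 < S -> Ck_on k `[0, S] h -> forall j, (j <= k)%N ->
  exists M, forall t, `[0, S]%classic t ->
    `|iter j (derive_within `[0, S]) h t| <= M.
Proof.
move=> S0 hk j jk.
have cj : {within `[0, S], continuous iter j (derive_within `[0, S]) h}.
  move: jk; rewrite leq_eqVlt => /predU1P[->|jk]; first exact: Ck_on_continuous.
  apply: diff_quot_within_continuous => t tS.
  by apply/cvg_ex; eexists; exact: (Ck_on_diff_quot hk jk tS).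
have [|c _ cM] := @EVT_max _
    (fun t => `|iter j (derive_within `[0, S]) h t|) 0 S (ltW S0).
  move=> t; apply: continuous_comp (cj t) _; exact: norm_continuous.
by exists `|iter j (derive_within `[0, S]) h c| => t tS; apply: cM.
Qed.

Lemma iter_derive_within_clin (X Y : normedModType R) (L : clin X Y) (S : R)
    (h : R -> X) k : 0 < S -> Ck_on k `[0, S] h ->
  forall j t, (j <= k)%N -> `[0, S]%classic t ->
  iter j (derive_within `[0, S]) (L \o h) t = L (iter j (derive_within `[0, S]) h t).
Proof.
move=> S0 hk; elim=> [//|j IHj] t jk St /=.
rewrite -derive_within_clin//; last first.
  by apply/cvg_ex; eexists; exact: (Ck_on_diff_quot hk jk St).
rewrite /derive_within
  (@eq_diff_quot_within _ _ _ _ (L \o iter j (derive_within `[0, S]) h))//.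
by move=> s Ss; rewrite IHj// ltnW.
Qed.

End TaylorBound.

(** * Truncation errors *)

Section InnerProductArith.
Context {R : realType} {H : hilbertType R}.
Implicit Types x y z : H.

Lemma hdotDl x y z : hdot (x + y) z = hdot x z + hdot y z.
Proof. by rewrite -[x in LHS]scale1r hdotPl mul1r. Qed.

Lemma hdot0l z : hdot (0 : H) z = 0.
Proof. by apply: (addrI (hdot (0 : H) z)); rewrite -hdotDl !addr0. Qed.

Lemma hdotZl a x z : hdot (a *: x) z = a * hdot x z.
Proof. by rewrite -[a *: x]addr0 hdotPl hdot0l addr0. Qed.

Lemma hdotNl x z : hdot (- x) z = - hdot x z.
Proof. by rewrite -scaleN1r hdotZl mulN1r. Qed.

Lemma hdotBl x y z : hdot (x - y) z = hdot x z - hdot y z.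
Proof. by rewrite hdotDl hdotNl. Qed.

Definition hdotE := (hdotBl, hdotDl, hdotZl, hdotNl).

(** Turns vector identities into real ones, which [ring] and [field] can settle. *)
Lemma hdot_inj x y : (forall z, hdot x z = hdot y z) -> x = y.
Proof.
move=> xy; apply/eqP; rewrite -subr_eq0 -normr_eq0 -sqrf_eq0 -hdot_norm.
by rewrite hdotBl xy subrr.
Qed.

Lemma norm_le_of_hdot x (M : R) : hdot x x <= M * `|x| -> 0 <= M -> `|x| <= M.
Proof.
move=> xM M0; have [->|x0] := eqVneq x 0; first by rewrite normr0.
by rewrite -(ler_pM2r (_ : 0 < `|x|)) ?normr_gt0// -expr2 -hdot_norm.
Qed.

Lemma hdot_le x y : hdot x y <= `|x| * `|y|.
Proof. exact: le_trans (ler_norm _) (cauchy_schwarz _ _). Qed.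

End InnerProductArith.

Lemma clin_le_abs {R : realType} (X : normedModType R) (L : dual X) x :
  L x <= `|L| * `|x|.
Proof. exact: le_trans (ler_norm _) (clin_le L x). Qed.

Lemma dualZ {R : realType} (X : normedModType R) (L : dual X) a x :
  (a *: L) x = a * L x.
Proof. by []. Qed.

Lemma dual_argZ {R : realType} (X : normedModType R) (L : dual X) a x :
  L (a *: x) = a * L x.
Proof. exact: clin_argZ. Qed.

(** * Trapezoidal and midpoint rules *)

Section Quadrature.
Context {R : realType} {X : hilbertType R} {S : R}.

(** Families indexed by the order replace iterated derivatives, so that tails of a family and images
    such as [Bm] of the derivatives of [g] fit as well. *)
Definition derivatives_on k (h : nat -> R -> X) : Prop :=
  forall j t, (j < k)%N -> `[0, S]%classic t ->
    diff_quot_within `[0, S] (h j) t --> h j.+1 t.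

Definition bounded_by M (h : R -> X) : Prop :=
  forall t, `[0, S]%classic t -> `|h t| <= M.

Lemma derivatives_on_shift m k h :
  derivatives_on (m + k) h -> derivatives_on k (fun j => h (m + j)%N).
Proof. by move=> dh j t jk St /=; rewrite addnS; apply: dh => //; rewrite ltn_add2l. Qed.

Lemma bounded_by_ge0 M h : 0 < S -> bounded_by M h -> 0 <= M.
Proof.
by move=> S0 bh; apply: le_trans (normr_ge0 _) (bh 0 _) => /=; rewrite in_itv/= lexx ltW.
Qed.

Variables (h : nat -> R -> X) (M s tau : R).
Hypotheses (tau0 : 0 <= tau) (s0 : 0 <= s) (stau : s + tau <= S).

Let tay k m : derivatives_on (m + k) h -> bounded_by M (h (m + k)%N) ->
  `|h m (s + tau) - \sum_(j < k) (tau ^+ j / j`!%:R) *: h (m + j)%N s|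
    <= M * tau ^+ k.
Proof.
move=> dh bh.
have := @taylor_le _ X S M (fun j => h (m + j)%N) k (derivatives_on_shift dh) bh
  s (s + tau) s0 _ stau.
by rewrite addn0 addrAC subrr add0r; apply; rewrite lerDl.
Qed.

Lemma taylor1_le m : derivatives_on m.+1 h -> bounded_by M (h m.+1) ->
  `|h m (s + tau) - h m s| <= M * tau.
Proof.
move=> dh bh; have := @tay 1%N m; rewrite addn1 => /(_ dh bh).
by rewrite big_ord1 expr0 fact0 divr1 scale1r addn0 expr1.
Qed.

Lemma taylor2_le m : derivatives_on m.+2 h -> bounded_by M (h m.+2) ->
  `|h m (s + tau) - (h m s + tau *: h m.+1 s)| <= M * tau ^+ 2.
Proof.
move=> dh bh; have := @tay 2%N m; rewrite addn2 => /(_ dh bh).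
by rewrite !big_ord_recl big_ord0 /= expr0 expr1 !divr1 scale1r !addnS !addn0 addr0.
Qed.

Lemma taylor3_le m : derivatives_on m.+3 h -> bounded_by M (h m.+3) ->
  `|h m (s + tau) - (h m s + tau *: h m.+1 s + (tau ^+ 2 / 2) *: h m.+2 s)|
    <= M * tau ^+ 3.
Proof.
move=> dh bh; have := @tay 3%N m; rewrite addn3 => /(_ dh bh).
by rewrite !big_ord_recl big_ord0 /= expr0 expr1 !divr1 scale1r !addnS !addn0 addr0 addrA.
Qed.

Lemma taylor4_le m : derivatives_on m.+4 h -> bounded_by M (h m.+4) ->
  `|h m (s + tau) - (h m s + tau *: h m.+1 s + (tau ^+ 2 / 2) *: h m.+2 s
    + (tau ^+ 3 / 6) *: h m.+3 s)| <= M * tau ^+ 4.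
Proof.
move=> dh bh; have := @tay 4%N m; rewrite addn4 => /(_ dh bh).
rewrite !big_ord_recl big_ord0 /= expr0 expr1 !divr1 scale1r.
by rewrite !addnS !addn0 addr0 !addrA.
Qed.

(** Both [h 0] and [h 1] are expanded at [s]. The terms with [h 2] cancel, which leaves one
    remainder of order 3 and [tau / 2] times one of order 2. *)
Lemma trapezoid_le : derivatives_on 3 h -> bounded_by M (h 3%N) -> 0 <= M ->
  `|h 0%N (s + tau) - h 0%N s - (tau / 2) *: (h 1%N s + h 1%N (s + tau))|
    <= (2 * M) * tau ^+ 3.
Proof.
move=> dh bh M0; have := @taylor3_le 0 dh bh; set a := (X in `|X|) => aM.
have := @taylor2_le 1 dh bh; set c := (X in `|X|) => cM.
have -> : h 0%N (s + tau) - h 0%N s - (tau / 2) *: (h 1%N s + h 1%N (s + tau)) =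
    a - (tau / 2) *: c.
  by apply: hdot_inj => z; rewrite /a /c !hdotE; field.
apply: le_trans (ler_normB _ _) _; rewrite normrZ ger0_norm ?divr_ge0//.
have : tau / 2 * `|c| <= tau / 2 * (M * tau ^+ 2) by rewrite ler_wpM2l// divr_ge0.
have : 0 <= M * tau ^+ 3 by rewrite mulr_ge0// exprn_ge0.
by lra.
Qed.

End Quadrature.

Arguments derivatives_on {R X} S k h.
Arguments bounded_by {R X} S M h.

(** The Taylor bounds only look to the right, so everything is expanded at the left end
    [s = t - tau / 2]; again the terms with [h 2] cancel. *)
Lemma midpoint_le {R : realType} (X : hilbertType R) (S : R) (h : nat -> R -> X)
    (M t tau : R) : 0 < tau -> 0 <= t - tau / 2 -> t + tau / 2 <= S ->
  derivatives_on S 3 h -> bounded_by S M (h 3%N) -> 0 <= M ->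
  `|h 1%N t - tau^-1 *: (h 0%N (t + tau / 2) - h 0%N (t - tau / 2))|
    <= (2 * M) * tau ^+ 2.
Proof.
move=> tau0 t0 tS dh bh M0; pose s := t - tau / 2.
have E1 : t + tau / 2 = s + tau by rewrite /s; field.
have E2 : t = s + tau / 2 by rewrite /s; field.
have th0 : 0 <= tau / 2 by rewrite divr_ge0// ltW.
have := @taylor3_le _ X S h M s tau (ltW tau0) t0 _ 0 dh bh.
rewrite -E1 => /(_ tS); set a := (X in `|X|) => aM.
have := @taylor2_le _ X S h M s (tau / 2) th0 t0 _ 1 dh bh.
rewrite -E2; have tS2 : t <= S by lra.
move=> /(_ tS2); set c := (X in `|X|) => cM.
have -> : h 1%N t - tau^-1 *: (h 0%N (t + tau / 2) - h 0%N (t - tau / 2)) =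
    c - tau^-1 *: a.
  by apply: hdot_inj => z; rewrite /a /c -/s !hdotE; field; rewrite gt_eqF.
apply: le_trans (ler_normB _ _) _; rewrite normrZ gtr0_norm ?invr_gt0//.
have : tau^-1 * `|a| <= M * tau ^+ 2.
  rewrite ler_pdivrMl//; apply: le_trans aM _.
  by rewrite le_eqVlt; apply/orP; left; apply/eqP; ring.
have : 0 <= M * tau ^+ 2 by rewrite mulr_ge0// sqr_ge0.
by move: cM; rewrite expr_div_n; lra.
Qed.

(* [tau ^+ 2 *: psi] is the leading part of the difference between the exact
   velocity and the average of neighbouring half-step velocities; subtracting it
   from the velocity error makes both error equations third-order accurate. *)
Definition half_step_corrector {R : realType} (X : hilbertType R)
    (h F : nat -> R -> X) (t : R) : X :=
  12^-1 *: h 3%N t - 4^-1 *: F 1%N t.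

Section HalfStepDefect.
Context {R : realType} {X : hilbertType R} {S : R}.
Variables (h F : nat -> R -> X) (M : R).
Hypotheses (M0 : 0 <= M) (dh : derivatives_on S 4 h) (bh : bounded_by S M (h 4%N)).
Hypotheses (dF : derivatives_on S 2 F) (bF : bounded_by S M (F 2%N)).
Variables (s tau : R).
Hypotheses (tau0 : 0 <= tau) (s0 : 0 <= s) (stau : s + tau <= S).

Let psi := half_step_corrector h F.

(** The left side is the averaging relation of the scheme, multiplied by [tau]. Expansion at [s]
    leaves [tau ^ 3] times [h 3 / 6 - F 1 / 2], which is [2 psi s]; replacing this by
    [psi s + psi (s + tau)] costs another [O(tau ^ 4)]. *)
Lemma half_step_defect_le :
  `|tau *: (h 1%N (s + tau) + h 1%N s) - 2 *: (h 0%N (s + tau) - h 0%N s)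
    - (tau ^+ 2 / 2) *: (F 0%N (s + tau) - F 0%N s)
    - tau ^+ 3 *: (psi s + psi (s + tau))| <= (5 * M) * tau ^+ 4.
Proof.
have := taylor4_le tau0 s0 stau (m := 0) dh bh; set a := (X in `|X|) => aM.
have := taylor3_le tau0 s0 stau (m := 1) dh bh; set c := (X in `|X|) => cM.
have := taylor1_le tau0 s0 stau (m := 3) dh bh; set d := (X in `|X|) => dM.
have := taylor2_le tau0 s0 stau (m := 0) dF bF; set p := (X in `|X|) => pM.
have := taylor1_le tau0 s0 stau (m := 1) dF bF; set q := (X in `|X|) => qM.
have -> : tau *: (h 1%N (s + tau) + h 1%N s) - 2 *: (h 0%N (s + tau) - h 0%N s)
    - (tau ^+ 2 / 2) *: (F 0%N (s + tau) - F 0%N s)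
    - tau ^+ 3 *: (psi s + psi (s + tau)) =
  tau *: c - 2 *: a - (tau ^+ 2 / 2) *: p - (tau ^+ 3 / 12) *: d
    + (tau ^+ 3 / 4) *: q.
  apply: hdot_inj => z.
  by rewrite /a /c /d /p /q /psi /half_step_corrector !hdotE; field.
have t2 : 0 <= tau ^+ 2 / 2 by rewrite divr_ge0// exprn_ge0.
have t3 : 0 <= tau ^+ 3 / 12 by rewrite divr_ge0// exprn_ge0.
have t4 : 0 <= tau ^+ 3 / 4 by rewrite divr_ge0// exprn_ge0.
apply: le_trans (ler_normD _ _) _; rewrite normrZ (ger0_norm t4).
apply: le_trans (lerD (ler_normB _ _) (lexx _)) _; rewrite normrZ (ger0_norm t3).
apply: le_trans (lerD (lerD (ler_normB _ _) (lexx _)) (lexx _)) _.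
rewrite normrZ (ger0_norm t2).
apply: le_trans (lerD (lerD (lerD (ler_normB _ _) (lexx _)) (lexx _)) (lexx _)) _.
rewrite !normrZ (ger0_norm tau0) [ `|2|]ger0_norm//.
have := ler_wpM2l tau0 cM; have := ler_wpM2l t2 pM.
have := ler_wpM2l t3 dM; have := ler_wpM2l t4 qM.
have : 0 <= M * tau ^+ 4 by rewrite mulr_ge0// exprn_ge0.
by lra.
Qed.

(** The corrector enters the Crank-Nicolson error equation only through [tau ^ 2] times this
    difference, hence with order 3. *)
Lemma half_step_corrector_lip : `|psi (s + tau) - psi s| <= M * tau.
Proof.
have := taylor1_le tau0 s0 stau (m := 3) dh bh; set d := (X in `|X|) => dM.
have := taylor1_le tau0 s0 stau (m := 1) dF bF; set q := (X in `|X|) => qM.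
have -> : psi (s + tau) - psi s = 12^-1 *: d - 4^-1 *: q.
  by apply: hdot_inj => z; rewrite /d /q /psi /half_step_corrector !hdotE; field.
apply: le_trans (ler_normB _ _) _; rewrite !normrZ !ger0_norm ?invr_ge0//.
by have : 0 <= M * tau by [rewrite mulr_ge0]; lra.
Qed.

End HalfStepDefect.

(** * Energy estimate *)

Section ScalarBounds.
Context {R : realType}.

Lemma sqr_sum5_le (p q r s t : R) : (p + q + r + s + t) ^+ 2 <=
  5 * (p ^+ 2 + q ^+ 2 + r ^+ 2 + s ^+ 2 + t ^+ 2).
Proof.
rewrite -subr_ge0.
rewrite (_ : _ - _ = (p - q) ^+ 2 + (p - r) ^+ 2 + (p - s) ^+ 2 + (p - t) ^+ 2
  + (q - r) ^+ 2 + (q - s) ^+ 2 + (q - t) ^+ 2 + (r - s) ^+ 2 + (r - t) ^+ 2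
  + (s - t) ^+ 2); last by ring.
by rewrite !addr_ge0 ?sqr_ge0.
Qed.

Lemma weighted_sum_le (a p q E : R) : 0 < a -> 0 <= p -> 0 <= q ->
  p + a * q <= E -> p + q <= (1 + a^-1) * E.
Proof.
move=> a0 p0 q0 pqE; have ainv : 0 < a^-1 by rewrite invr_gt0.
have : a^-1 * (p + a * q) <= a^-1 * E by rewrite ler_wpM2l// ltW.
rewrite mulrDr mulrA mulVf ?gt_eqF// mul1r.
have : 0 <= a^-1 * p by rewrite mulr_ge0// ltW.
have : 0 <= a * q by rewrite mulr_ge0// ltW.
by lra.
Qed.

(** The equation is the averaging relation tested with [iota eta]. Here [y] is the norm of
    [iota eta], [S] and [S'] are those of the corrected velocity errors, [x] and [x'] those of the
    position errors. All terms besides [2 y ^ 2] are at most a multiple of [y]; dividing by [y]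
    gives a linear bound free of [1 / t]. *)
Lemma half_step_size (L K T t S S' x x' y hs hs' p r : R) :
  0 <= L -> 0 <= K -> 0 < t <= T -> 0 <= S -> 0 <= S' -> 0 <= x -> 0 <= x' -> 0 <= y ->
  hs' + hs - 2 * y ^+ 2 = t / 2 * p + r -> hs <= S * y -> hs' <= S' * y ->
  - p <= L * (x + x') * y -> - r <= K * t ^+ 3 * y ->
  y <= (1 + L * T + K * T) * (S + S' + x + x' + t ^+ 2).
Proof.
move=> L0 K0 /andP[t0 tT] S0 S'0 x0 x'0 y0 E hsS hsS' hp hr.
have T0 : 0 <= T by exact: le_trans (ltW t0) tT.
have t20 : 0 <= t ^+ 2 by exact: sqr_ge0.
have LT : 0 <= L * T by exact: mulr_ge0.
have KT : 0 <= K * T by exact: mulr_ge0.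
have xx : 0 <= x + x' by exact: addr_ge0.
have SS : 0 <= S + S' by exact: addr_ge0.
have -> : (1 + L * T + K * T) * (S + S' + x + x' + t ^+ 2) =
  (S + S') + (x + x') + t ^+ 2 + (L * T) * (S + S') + (L * T) * (x + x')
  + (L * T) * t ^+ 2 + (K * T) * (S + S') + (K * T) * (x + x') + (K * T) * t ^+ 2 by ring.
have k1 := mulr_ge0 LT SS; have k2 := mulr_ge0 LT t20.
have k3 := mulr_ge0 KT SS; have k4 := mulr_ge0 KT xx.
have k5 := mulr_ge0 LT xx; have k6 := mulr_ge0 KT t20.
suff : y <= S + S' + L * T * (x + x') + K * T * t ^+ 2 by lra.
have [->|yn0] := eqVneq y 0; first by rewrite !addr_ge0.
have yp : 0 < y by rewrite lt_neqAle eq_sym yn0.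
rewrite -(ler_pM2r yp) -expr2.
have d1 : t * (L * (x + x') * y) <= T * (L * (x + x') * y).
  by rewrite ler_wpM2r// !mulr_ge0.
have d2 : t * (K * t ^+ 2 * y) <= T * (K * t ^+ 2 * y).
  by rewrite ler_wpM2r// !mulr_ge0// ltW.
have d3 : t * - p <= t * (L * (x + x') * y) by rewrite ler_wpM2l// ltW.
have d4 : 0 <= L * T * (x + x') * y by rewrite !mulr_ge0.
have d5 : 0 <= K * T * t ^+ 2 * y by rewrite !mulr_ge0// ltW.
have d6 : 0 <= S * y by rewrite !mulr_ge0.
have d7 : 0 <= S' * y by rewrite !mulr_ge0.
clear -E hsS hsS' hr d1 d2 d3 d4 d5 d6 d7; lra.
Qed.

(** All norms, and the factor [t ^ 2] of the defects, are dominated by multiples of [Z], so every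
    product of two is a multiple of [Z ^ 2]. The damping term [d] has the good sign. *)
Lemma energy_increment_le (a2 L K t S S' x x' y c d g1 g2 r1 g4 r2 : R) :
  let Z := S + S' + x + x' + t ^+ 2 in
  0 <= a2 -> 0 <= L -> 0 <= K -> 0 < t -> 0 <= S -> 0 <= S' -> 0 <= x -> 0 <= x' ->
  0 <= y -> y <= c * Z -> 0 <= c -> 0 <= d ->
  g1 <= a2 * (x + x') * y -> g2 <= L * (x + x') * y -> r1 <= K * t ^+ 3 * y ->
  g4 <= L * (x + x') * (S + S') -> r2 <= K * t ^+ 3 * (S + S') ->
  - 2 * d + t * g1 + t * g2 + 2 * r1 + t / 2 * g4 + r2 <=
  ((a2 + L + 2 * K) * c + L + K) * t * Z ^+ 2.
Proof.
move=> Z a20 L0 K0 t0 S0 S'0 x0 x'0 y0 yZ c0 d0 h1 h2 h3 h4 h5.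
have t20 : 0 <= t ^+ 2 by exact: sqr_ge0.
have Z0 : 0 <= Z by rewrite !addr_ge0.
have xZ : 0 <= x + x' <= Z by rewrite addr_ge0//= /Z; lra.
have SZ : 0 <= S + S' <= Z by rewrite addr_ge0//= /Z; lra.
have tZ : 0 <= t ^+ 2 <= Z by rewrite t20 /Z; lra.
have ZZ (p q m : R) : 0 <= p <= Z -> 0 <= q -> q <= m * Z -> p * q <= m * Z ^+ 2.
  move=> /andP[p0 pZ] q0 qm; rewrite expr2 mulrCA; exact: ler_pM.
have SZ1 : S + S' <= 1 * Z by rewrite mul1r; case/andP: SZ.
have SS0 : 0 <= S + S' by case/andP: SZ.
have xy := ZZ _ _ _ xZ y0 yZ; have ty := ZZ _ _ _ tZ y0 yZ.
have xs := ZZ _ _ _ xZ SS0 SZ1; have ts := ZZ _ _ _ tZ SS0 SZ1.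
have tm (p q r m : R) : 0 <= m -> p <= m * q -> q <= r -> t * p <= t * (m * r).
  move=> m0 pq qr; rewrite ler_wpM2l ?(ltW t0)//; apply: le_trans pq _.
  by rewrite ler_wpM2l.
rewrite -mulrA in h1; rewrite -mulrA in h2; rewrite -mulrA in h4.
have h3' : r1 / t <= K * (t ^+ 2 * y).
  by rewrite ler_pdivrMr//; apply: le_trans h3 _; rewrite le_eqVlt; apply/orP; left;
    apply/eqP; ring.
have h5' : r2 / t <= K * (t ^+ 2 * (S + S')).
  by rewrite ler_pdivrMr//; apply: le_trans h5 _; rewrite le_eqVlt; apply/orP; left;
    apply/eqP; ring.
have k1 := tm _ _ _ _ a20 h1 xy; have k2 := tm _ _ _ _ L0 h2 xy.
have k3 := tm _ _ _ _ K0 h3' ty; have k4 := tm _ _ _ _ L0 h4 xs.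
have k5 := tm _ _ _ _ K0 h5' ts.
have tn0 : t != 0 by rewrite gt_eqF.
rewrite [_ / t]mulrC mulVKf// in k3; rewrite [_ / t]mulrC mulVKf// in k5.
have Z2 : 0 <= t * (L * (1 * Z ^+ 2)).
  by rewrite mulr_ge0 ?(ltW t0)// mulr_ge0// mul1r sqr_ge0.
clear -d0 k1 k2 k3 k4 k5 Z2; by lra.
Qed.

End ScalarBounds.

Section EnergyEstimate.
Context {R : realType} {V H Q : hilbertType R}.
Variables (iota : clin V H) (B : clin V (dual Q)).
Variables (A A1 : clin V (dual V)) (DV : clin V (dual H)).
Hypothesis hD : forall v, 0 <= DV v (iota v).

(** Testing only on [Vker] and [Hker] removes the multipliers. The first equation is the
    Crank-Nicolson step, the second the averaging relation; [eta] is the half-step velocity error,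
    [F] and [F'] are errors of the nonlinearity, [r1] and [r2] truncation errors. *)
Definition error_step (K tau : R) (e e' : V) (s s' : H) (F F' : dual H) : Prop :=
  exists eta : V, exists r1 r2 : dual H,
  [/\ Vker B eta, e' = e + tau *: eta,
      forall v, Vker B v ->
        hdot (s' - s) (iota v) + tau * DV eta (iota v) + tau / 2 * A (e + e') v =
        tau / 2 * (F + F') (iota v) + r1 (iota v),
      forall h, Hker iota B h ->
        hdot (s' + s - 2 *: iota eta) h = tau / 2 * (F' - F) h + r2 h &
      `|r1| <= K * tau ^+ 3 /\ `|r2| <= K * tau ^+ 3].

Definition energy (s : H) (e : V) : R := `|s| ^+ 2 + A1 e e.

Lemma Hker_iota v : Vker B v -> Hker iota B (iota v).
Proof. by move=> kv; apply: subset_closure; exists v. Qed.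

(** Subtracting the two error equations tested with [eta] eliminates [s'] and also [F']. So no
    Lipschitz bound at the new time level enters, and the estimate can be used to place [e'] in the
    ball where that bound holds. *)
Lemma half_step_apriori_bound (a L K T : R) : 0 < a -> 0 <= L -> 0 <= K -> 0 < T ->
  (forall v, Vker B v -> a * `|v| ^+ 2 <= A v v) ->
  exists2 C : R, 0 <= C &
  forall (tau : R) (e e' : V) (s s' : H) (F F' : dual H), 0 < tau <= T ->
    `|F| <= L * `|e| -> error_step K tau e e' s s' F F' -> Hker iota B s ->
    `|e' - e| ^+ 2 <= C * (`|s| ^+ 2 + `|e| ^+ 2 + tau ^+ 4).
Proof.
move=> a0 L0 K0 T0 hA.
pose c1 := L * T; pose c2 := K * T.
have [c10 c20] : 0 <= c1 /\ 0 <= c2 by rewrite !mulr_ge0// ltW.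
pose N := `|A|.
(* From Young's inequality below: [3] from squaring a sum of three terms, [1 / 4] from absorbing
   [y ^ 2], and [2 N ^ 2 / a] from giving up half of the coercivity [a / 4]. *)
pose D := 3 / 4 * (1 + c1 ^+ 2 + c2 ^+ 2) + 2 * N ^+ 2 / a.
have D0 : 0 <= D.
  rewrite /D addr_ge0//; first by rewrite mulr_ge0 ?divr_ge0 ?addr_ge0 ?sqr_ge0.
  by rewrite divr_ge0 ?(ltW a0)// mulr_ge0 ?sqr_ge0.
exists (8 / a * D); first by rewrite mulr_ge0// divr_ge0// ltW.
move=> tau e e' s s' F F' /andP[tau0 tauT] hF.
move=> [eta [r1 [r2 [keta -> E1 E2 [hr1 hr2]]]]] ks.
rewrite addrAC subrr add0r normrZ gtr0_norm//.
have := E1 _ keta; have := E2 _ (Hker_iota keta).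
set y := `|iota eta|; set x := `|e|; set p := tau * `|eta|.
rewrite !hdotE !clin_argD !clin_argZ !clinD clinN dualZ.
rewrite hdot_norm -/y => E2e E1e.
have Ae := hA _ keta.
have De := hD eta.
have := hdot_le s (iota eta); rewrite -/y => sy.
have := clin_le_abs F (iota eta); rewrite -/y => Fy.
have := clin_le_abs r1 (iota eta); rewrite -/y => r1y.
have := clin_le_abs (- r2) (iota eta); rewrite -/y normrN clinN => r2y.
have y0 : 0 <= y by exact: normr_ge0.
have x0 : 0 <= x by exact: normr_ge0.
have p0 : 0 <= p by rewrite mulr_ge0// ltW.
have Aee : - (A e eta) <= N * x * `|eta|.
  apply: le_trans (ler_norm _) _; rewrite normrN.
  by apply: le_trans (clin_le _ _) _; rewrite ler_wpM2r//; exact: clin_le.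
have F1 : F (iota eta) <= L * x * y by apply: le_trans Fy _; rewrite ler_wpM2r.
have R1 : r1 (iota eta) <= K * tau ^+ 3 * y by apply: le_trans r1y _; rewrite ler_wpM2r.
have R2 : - r2 (iota eta) <= K * tau ^+ 3 * y by apply: le_trans r2y _; rewrite ler_wpM2r.
have main : y ^+ 2 + a / 4 * p ^+ 2 <=
    (`|s| + c1 * x + c2 * tau ^+ 2) * y + N * x * p.
  have t1 : tau ^+ 2 * (a * `|eta| ^+ 2) <= tau ^+ 2 * A eta eta.
    by rewrite ler_wpM2l// sqr_ge0.
  have t2 : tau * - A e eta <= tau * (N * x * `|eta|) by rewrite ler_wpM2l// ltW.
  have t3 : tau * F (iota eta) <= tau * (L * x * y) by rewrite ler_wpM2l// ltW.
  have t4 : tau * (L * x * y) <= T * (L * x * y) by rewrite ler_wpM2r// !mulr_ge0.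
  have t5 : tau * (K * tau ^+ 2 * y) <= T * (K * tau ^+ 2 * y).
    by rewrite ler_wpM2r// !mulr_ge0// ltW.
  have t6 : 0 <= tau * DV eta (iota eta) by rewrite mulr_ge0// ltW.
  have t7 : 0 <= T * (L * x * y) by rewrite !mulr_ge0// ltW.
  have t8 : 0 <= N * x * p by exact: mulr_ge0 (mulr_ge0 (normr_ge0 _) x0) p0.
  rewrite /c1 /c2 /p in t8 *; lra.
set q := `|s| + c1 * x + c2 * tau ^+ 2 in main.
have q1 : q * y <= y ^+ 2 + q ^+ 2 / 4 by have := sqr_ge0 (y - q / 2); lra.
have q2 : N * x * p <= a / 8 * p ^+ 2 + 2 * N ^+ 2 / a * x ^+ 2.
  rewrite -subr_ge0.
  have -> : a / 8 * p ^+ 2 + 2 * N ^+ 2 / a * x ^+ 2 - N * x * p =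
    a / 8 * (p - 4 * N / a * x) ^+ 2 by field; rewrite gt_eqF.
  by rewrite mulr_ge0 ?sqr_ge0// divr_ge0// ltW.
have q3 : q ^+ 2 <= 3 * (`|s| ^+ 2 + c1 ^+ 2 * x ^+ 2 + c2 ^+ 2 * tau ^+ 4).
  have q4 := sqr_ge0 (`|s| - c1 * x); have q5 := sqr_ge0 (`|s| - c2 * tau ^+ 2).
  have q6 := sqr_ge0 (c1 * x - c2 * tau ^+ 2); rewrite /q; lra.
have s2 : 0 <= `|s| ^+ 2 by exact: sqr_ge0.
have x2 : 0 <= x ^+ 2 by exact: sqr_ge0.
have t4 : 0 <= tau ^+ 4 by rewrite exprn_ge0// ltW.
have w1 : 0 <= 2 * N ^+ 2 / a * (`|s| ^+ 2 + tau ^+ 4).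
  by rewrite mulr_ge0 ?addr_ge0// divr_ge0 ?(ltW a0)// mulr_ge0 ?sqr_ge0.
have w2 : 0 <= c1 ^+ 2 * (`|s| ^+ 2 + tau ^+ 4) by rewrite mulr_ge0 ?addr_ge0// sqr_ge0.
have w3 : 0 <= c2 ^+ 2 * (`|s| ^+ 2 + x ^+ 2) by rewrite mulr_ge0 ?addr_ge0// sqr_ge0.
rewrite -[_ * D * _]mulrA -ler_pdivrMl ?divr_gt0// invf_div.
rewrite /D; lra.
Qed.

End EnergyEstimate.

(** * Growth of the energy in one step *)

Section EnergyStep.
Context {R : realType} {V H Q : hilbertType R}.
Variables (iota : clin V H) (B : clin V (dual Q)).
Variables (A A1 : clin V (dual V)) (A2 DV : clin V (dual H)).
Hypotheses (hA12 : forall v, A v = A1 v + restr iota (A2 v))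
  (hA1sym : forall v w, A1 v w = A1 w v) (hD : forall v, 0 <= DV v (iota v)).
Variable a : R.
Hypothesis hA1 : forall v, Vker B v -> a * `|v| ^+ 2 <= A1 v v.

Lemma energy_ge (s : H) (e : V) : Vker B e -> `|s| ^+ 2 + a * `|e| ^+ 2 <= energy A1 s e.
Proof. by move=> ke; rewrite lerD2l hA1. Qed.

Lemma Vker_step v w t : Vker B v -> Vker B w -> Vker B (v + t *: w).
Proof.
by rewrite /Vker /= => kv kw; rewrite clin_argD clin_argZ kv kw scaler0 addr0.
Qed.

(** Twice the first error equation tested with [eta] and the second tested with [s' - s] combine to
    [id1], the mixed terms cancelling. Since [A2] maps into the dual of [H], its term needs only the
    norm of [iota eta], which [half_step_size] bounds without dividing by [tau]. *)
Lemma energy_step (L K T : R) : 0 < a -> 0 <= L -> 0 <= K -> 0 < T ->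
  exists2 C : R, 0 < C &
  forall (tau : R) (e e' : V) (s s' : H) (F F' : dual H),
  0 < tau <= T -> `|F| <= L * `|e| -> `|F'| <= L * `|e'| ->
  error_step iota B A DV K tau e e' s s' F F' ->
  Hker iota B s -> Hker iota B s' -> Vker B e ->
  energy A1 s' e' - energy A1 s e <=
    C * tau * (energy A1 s e + energy A1 s' e' + tau ^+ 4).
Proof.
move=> a0 L0 K0 T0; pose c1 := 1 + L * T + K * T; pose a2 : R := `|A2|.
pose c2 := (a2 + L + 2 * K) * c1 + L + K + 1.
have TL : 0 <= L * T by rewrite mulr_ge0// ltW.
have TK : 0 <= K * T by rewrite mulr_ge0// ltW.
have c10 : 1 <= c1 by rewrite /c1 -addrA lerDl addr_ge0.
have a20 : 0 <= a2 by exact: normr_ge0.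
have c20 : 0 < c2.
  have a2L : 0 <= a2 + L + 2 * K by rewrite !addr_ge0// mulr_ge0.
  by rewrite /c2 ltr_wpDl// !addr_ge0// mulr_ge0// (le_trans ler01).
(* The factor [5] comes from squaring a sum of five terms, [1 + a^-1] from passing from norms to the
   energy. *)
exists (5 * c2 * (1 + a^-1)).
  by rewrite !mulr_gt0// addr_gt0// invr_gt0.
move=> tau e e' s s' F F' /andP[tau0 tauT] hF hF'.
move=> [eta [r1 [r2 [keta e'E E1 E2 [hr1 hr2]]]]] ks ks' ke.
have ke' : Vker B e' by rewrite e'E; exact: Vker_step.
have E2s := E2 _ ks; have E2s' := E2 _ ks'.
have E2e := E2 _ (Hker_iota keta).
have := E1 _ keta; rewrite hA12 (addrC F) => E1e.
have GE := energy_ge s ke; have GE' := energy_ge s' ke'.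
have Ediff : tau * A1 (e + e') eta = A1 e' e' - A1 e e.
  have -> : tau * A1 (e + e') eta = A1 (e + e') (e' - e).
    by rewrite e'E addrAC subrr add0r dual_argZ.
  by rewrite clin_argB !clin_argD !clinD (hA1sym e' e); ring.
set y := `|iota eta|; set x := `|e|; set x' := `|e'|.
set S := `|s|; set S' := `|s'|.
have y0 : 0 <= y by exact: normr_ge0.
have x0 : 0 <= x by exact: normr_ge0.
have x'0 : 0 <= x' by exact: normr_ge0.
have S0 : 0 <= S by exact: normr_ge0.
have S'0 : 0 <= S' by exact: normr_ge0.
have Fle (G G' : dual H) (z : H) (m : R) : `|G| <= L * x -> `|G'| <= L * x' ->
    `|z| <= m -> (G' + G) z <= L * (x + x') * m.
  move=> hG hG' zm; apply: le_trans (clin_le_abs _ _) _.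
  apply: ler_pM => //; apply: le_trans (ler_normD _ _) _; rewrite mulrDr; lra.
have rle (r : dual H) (z : H) (m : R) : `|r| <= K * tau ^+ 3 -> `|z| <= m ->
    r z <= K * tau ^+ 3 * m.
  by move=> hr zm; apply: le_trans (clin_le_abs _ _) _; exact: ler_pM.
have hNF : `|- F| <= L * x by rewrite normrN.
have dS : `|s' - s| <= S + S' by rewrite (addrC S); exact: ler_normB.
have yZ : y <= c1 * (S + S' + x + x' + tau ^+ 2).
  have hNF' : `|- F'| <= L * x' by rewrite normrN.
  have hNr2 : `|- r2| <= K * tau ^+ 3 by rewrite normrN.
  have b1 := Fle F (- F') (iota eta) y hF hNF' (lexx _).
  have b2 := rle (- r2) (iota eta) y hNr2 (lexx _).
  have b3 := hdot_le s (iota eta); have b4 := hdot_le s' (iota eta).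
  move: E2e; rewrite !hdotE hdot_norm -/y => E2e.
  have tT : 0 < tau <= T by rewrite tau0.
  apply: (half_step_size L0 K0 tT S0 S'0 x0 x'0 y0 E2e b3 b4 _ b2).
  by rewrite clinB opprB addrC; exact: b1.
have hNF2 : `|- A2 (e + e')| <= a2 * (x + x').
  rewrite normrN; apply: le_trans (clin_le _ _) _.
  by rewrite ler_wpM2l// ler_normD.
have g1 : - A2 (e + e') (iota eta) <= a2 * (x + x') * y.
  apply: le_trans (clin_le_abs (- A2 (e + e')) _) _.
  by rewrite ler_wpM2r.
have g2 := Fle F F' (iota eta) y hF hF' (lexx _).
have g3 := rle r1 (iota eta) y hr1 (lexx _).
have g4 := Fle (- F) F' (s' - s) (S + S') hNF hF' dS.
have g5 := rle r2 (s' - s) (S + S') hr2 dS.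
have g6 := mulr_ge0 (ltW tau0) (hD eta).
have id1 : energy A1 s' e' - energy A1 s e = - 2 * (tau * DV eta (iota eta))
    + tau * - A2 (e + e') (iota eta) + tau * (F' + F) (iota eta)
    + 2 * r1 (iota eta) + tau / 2 * (F' - F) (s' - s) + r2 (s' - s).
  rewrite /energy -!hdot_norm (clin_argB r2) (clin_argB (F' - F)).
  move: E1e E2s E2s' Ediff; have -> : (A1 (e + e') + restr iota (A2 (e + e'))) eta =
    A1 (e + e') eta + A2 (e + e') (iota eta) by [].
  rewrite !hdotE !(hdotC (iota eta)) (hdotC s' s).
  lra.
have Z2 : 0 <= tau * (S + S' + x + x' + tau ^+ 2) ^+ 2 by rewrite mulr_ge0 ?sqr_ge0// ltW.
have fin1 : energy A1 s' e' - energy A1 s e <=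
    tau * (c2 * (S + S' + x + x' + tau ^+ 2) ^+ 2).
  rewrite id1; apply: le_trans (energy_increment_le a20 L0 K0 tau0 S0 S'0 x0 x'0
    y0 yZ (le_trans ler01 c10) g6 g1 g2 g3 g4 g5) _.
  by rewrite -mulrA mulrCA /c2 -subr_ge0; apply: le_trans Z2 _;
    rewrite le_eqVlt; apply/orP; left; apply/eqP; ring.
apply: le_trans fin1 _.
have -> : 5 * c2 * (1 + a^-1) * tau * (energy A1 s e + energy A1 s' e' + tau ^+ 4) =
  tau * (c2 * (5 * ((1 + a^-1) * (energy A1 s e + energy A1 s' e' + tau ^+ 4)))) by ring.
rewrite ler_wpM2l ?(ltW tau0)// ler_wpM2l ?(ltW c20)//.
have h2 := weighted_sum_le a0 (sqr_ge0 _) (sqr_ge0 _) GE.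
have h3 := weighted_sum_le a0 (sqr_ge0 _) (sqr_ge0 _) GE'.
apply: le_trans (sqr_sum5_le _ _ _ _ _) _; rewrite ler_wpM2l//.
rewrite -exprM mulrDr mulrDr.
have t4 : tau ^+ 4 <= (1 + a^-1) * tau ^+ 4.
  by rewrite ler_peMl ?exprn_ge0 ?(ltW tau0)// lerDl invr_ge0 ltW.
rewrite -/S -/x in h2; rewrite -/S' -/x' in h3.
apply: le_trans (lerD (lerD h2 h3) t4); rewrite le_eqVlt; apply/orP; left.
by apply/eqP; rewrite [(2 * 2)%N]/=; ring.
Qed.

End EnergyStep.

(** * Discrete Gronwall argument *)

Section Stability.
Context {R : realType} {V H Q : hilbertType R}.
Variables (iota : clin V H) (B : clin V (dual Q)).
Variables (A A1 : clin V (dual V)) (A2 DV : clin V (dual H)).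
Hypotheses (hA12 : forall v, A v = A1 v + restr iota (A2 v))
  (hA1sym : forall v w, A1 v w = A1 w v) (hD : forall v, 0 <= DV v (iota v)).

(** Absorbing [E'] gives the factor [(1 + x) / (1 - x)], which is at most [1 + 4 x] for
    [x <= 1 / 2]. *)
Lemma growth_of_increment (x E E' q : R) : 0 < x <= 1 / 2 -> 0 <= E -> 0 <= q ->
  E' - E <= x * (E + E' + q) -> E' + q <= (1 + 4 * x) * (E + q).
Proof.
move=> /andP[x0 x1] E0 q0 h.
have x1' : 0 < 1 - x by lra.
rewrite -(ler_pM2l x1').
have k1 : 0 <= x * q by rewrite mulr_ge0// ltW.
have k2 : 0 <= x * (1 - 2 * x) * (E + q).
  have x2 : 0 <= 1 - 2 * x by lra.
  exact: mulr_ge0 (mulr_ge0 (ltW x0) x2) (addr_ge0 E0 q0).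
by lra.
Qed.

(** The Lipschitz bound holds only while the error is at most [1]. The induction carries the energy
    bound, which yields [|e n| <= 1 / 2]; the a priori bound yields [|e n.+1 - e n| <= 1 / 2]; only
    then does the energy estimate apply. *)
Lemma stability (a L K T : R) : 0 < a -> 0 <= L -> 0 <= K -> 0 < T ->
  (forall v, Vker B v -> a * `|v| ^+ 2 <= A v v) ->
  (forall v, Vker B v -> a * `|v| ^+ 2 <= A1 v v) ->
  exists2 tau0 : R, 0 < tau0 & exists2 M : R, 0 <= M &
  forall (tau : R) (N : nat) (e : nat -> V) (s : nat -> H) (F : nat -> dual H),
  0 < tau <= tau0 -> N%:R * tau = T -> e 0%N = 0 -> `|s 0%N| <= K * tau ^+ 2 ->
  (forall n, (n <= N)%N -> Vker B (e n) /\ Hker iota B (s n)) ->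
  (forall n, (n <= N)%N -> `|e n| <= 1 -> `|F n| <= L * `|e n|) ->
  (forall n, (n < N)%N ->
    error_step iota B A DV K tau (e n) (e n.+1) (s n) (s n.+1) (F n) (F n.+1)) ->
  forall n, (n <= N)%N -> `|e n| <= M * tau ^+ 2 /\ `|s n| <= M * tau ^+ 2.
Proof.
move=> a0 L0 K0 T0 hA hA1.
have [k k0 kP] := energy_step hA12 hA1sym hD hA1 a0 L0 K0 T0.
have [C C0 CP] := half_step_apriori_bound hD a0 L0 K0 T0 hA.
pose G : R := expR (4 * k * T) * (K ^+ 2 + 1).
have G0 : 0 <= G by rewrite mulr_ge0 ?expR_ge0// addr_ge0 ?sqr_ge0.
have Ga0 : 0 <= G / a by rewrite divr_ge0// ltW.
(* [M] bounds the sum in the a priori estimate and, because [M <= M ^ 2], also serves after taking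
   square roots. *)
pose M := 1 + G + G / a.
have M1 : 1 <= M by rewrite /M -addrA lerDl addr_ge0.
(* [W tau ^ 4] dominates both [|e n| ^ 2] and [|e n.+1 - e n| ^ 2]. *)
pose W := G / a + C * M + 1.
have CM0 : 0 <= C * M by rewrite mulr_ge0// (le_trans ler01).
have W0 : 0 < W by rewrite /W ltr_wpDl// addr_ge0.
(* In turn: [tau <= T] for the one-step lemmas, [tau ^ 4 <= tau], [k tau <= 1 / 2] for the growth
   lemma, and [W tau <= 1 / 4], which makes the two norms at most [1 / 2]. *)
exists (Num.min (Num.min T 1) (Num.min (2 * k)^-1 (4 * W)^-1)).
  by rewrite !lt_min T0 ltr01 !invr_gt0 !mulr_gt0.
exists M; first exact: le_trans M1.
move=> tau N e s F /andP[tau0].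
rewrite !le_min => /andP[/andP[tT t1] /andP[tk tW]] NT e0 s0 ker lip step.
have t4 : 0 <= tau ^+ 4 by rewrite exprn_ge0// ltW.
have kt : k * tau <= 1 / 2.
  rewrite mulrC -ler_pdivlMr//; apply: le_trans tk _.
  by rewrite invfM mul1r.
have tW4 : W * tau ^+ 4 <= 4^-1.
  apply: (@le_trans _ _ (W * tau)).
    rewrite ler_wpM2l ?(ltW W0)// exprSr -[leRHS]mul1r ler_wpM2r ?(ltW tau0)//.
    by rewrite exprn_ile1// ltW.
  by rewrite mulrC -ler_pdivlMr// -invfM.
have TtT : 0 < tau <= T by rewrite tau0.
have grow n : (n <= N)%N -> (1 + 4 * (k * tau)) ^+ n <= expR (4 * k * T).
  move=> nN; apply: (@le_trans _ _ (expR (4 * (k * tau)) ^+ n)).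
    rewrite lerXn2r ?nnegrE ?expR_ge0 ?expR_ge1Dx//.
    by rewrite addr_ge0// !mulr_ge0// ltW.
  rewrite -expRM_natl ler_expR -NT.
  rewrite (_ : 4 * k * (N%:R * tau) = N%:R * (4 * (k * tau))); last by ring.
  rewrite ler_wpM2r ?ler_nat//.
  by rewrite !mulr_ge0// ltW.
have small n : (n <= N)%N ->
    energy A1 (s n) (e n) + tau ^+ 4 <=
      (1 + 4 * (k * tau)) ^+ n * ((K ^+ 2 + 1) * tau ^+ 4) ->
    [/\ `|s n| ^+ 2 <= G * tau ^+ 4, `|e n| ^+ 2 <= G / a * tau ^+ 4 &
        0 <= energy A1 (s n) (e n)].
  move=> nN h; have [ke _] := ker n nN.
  have hE := energy_ge hA1 (s n) ke.
  have hG : energy A1 (s n) (e n) <= G * tau ^+ 4.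
    apply: (@le_trans _ _ (energy A1 (s n) (e n) + tau ^+ 4)); first by rewrite lerDl.
    apply: le_trans h _; rewrite /G mulrA ler_wpM2r// ler_wpM2r ?grow//.
    by rewrite addr_ge0 ?sqr_ge0.
  have s2 : 0 <= `|s n| ^+ 2 by exact: sqr_ge0.
  have e2 : 0 <= a * `|e n| ^+ 2 by rewrite mulr_ge0 ?sqr_ge0// ltW.
  split; last by apply: le_trans hE; rewrite addr_ge0.
    by apply: le_trans hG; apply: le_trans hE; rewrite lerDl.
  rewrite mulrAC ler_pdivlMr// mulrC.
  by apply: le_trans hG; apply: le_trans hE; rewrite lerDr.
have norm_half (v : V) : `|v| ^+ 2 <= W * tau ^+ 4 -> `|v| <= 2^-1.
  move=> h; rewrite -(@ler_pXn2r _ 2)// ?nnegrE ?invr_ge0//.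
  by apply: le_trans h (le_trans tW4 _); rewrite exprVn -natrX.
have main n : (n <= N)%N -> energy A1 (s n) (e n) + tau ^+ 4 <=
    (1 + 4 * (k * tau)) ^+ n * ((K ^+ 2 + 1) * tau ^+ 4).
  elim: n => [_|n IHn nN].
    rewrite e0 expr0 mul1r /energy clin_arg0 addr0 mulrDl mul1r lerD2r.
    rewrite (_ : K ^+ 2 * tau ^+ 4 = (K * tau ^+ 2) ^+ 2); last by ring.
    by rewrite lerXn2r ?nnegrE// mulr_ge0// sqr_ge0.
  have nN' : (n <= N)%N by exact: ltnW.
  have {}IHn := IHn nN'; have [sn en En] := small n nN' IHn.
  have [ke ks] := ker n nN'; have [ke' ks'] := ker n.+1 nN.
  have en2 : `|e n| <= 2^-1.
    apply: norm_half; apply: le_trans en _; rewrite ler_wpM2r// /W -addrA lerDl.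
    by rewrite addr_ge0.
  have Fn : `|F n| <= L * `|e n|.
    by apply: lip => //; apply: le_trans en2 _; rewrite invf_le1// ler1n.
  have ed : `|e n.+1 - e n| <= 2^-1.
    apply: norm_half; apply: le_trans (CP _ _ _ _ _ _ _ TtT Fn (step n nN) ks) _.
    rewrite /W mulrDl mulrDl.
    apply: (@le_trans _ _ (C * M * tau ^+ 4)); last first.
      rewrite -addrA addrCA lerDl.
      exact: addr_ge0 (mulr_ge0 Ga0 t4) (mulr_ge0 ler01 t4).
    rewrite -mulrA ler_wpM2l// /M !mulrDl mul1r.
    by rewrite -[leRHS]addrA [leRHS]addrC lerD// lerD.
  have Fn' : `|F n.+1| <= L * `|e n.+1|.
    apply: lip => //; rewrite -(subrK (e n) (e n.+1)).
    apply: le_trans (ler_normD _ _) _; apply: le_trans (lerD ed en2) _.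
    by rewrite le_eqVlt; apply/orP; left; apply/eqP; field.
  have inc := kP _ _ _ _ _ _ _ TtT Fn Fn' (step n nN) ks ks' ke.
  have kt2 : 0 < k * tau <= 1 / 2 by rewrite mulr_gt0.
  apply: le_trans (growth_of_increment kt2 En t4 inc) _.
  by rewrite [_ ^+ n.+1]exprS -mulrA ler_wpM2l// addr_ge0// !mulr_ge0// ltW.
move=> n nN; have [sn en _] := small n nN (main n nN).
have MG : G <= M ^+ 2.
  apply: (@le_trans _ _ M); first by rewrite /M addrAC lerDr addr_ge0.
  by rewrite expr2 ler_peMl// (le_trans ler01).
have MGa : G / a <= M ^+ 2.
  apply: (@le_trans _ _ M); first by rewrite /M lerDr addr_ge0.
  by rewrite expr2 ler_peMl// (le_trans ler01).
have Mt : 0 <= M * tau ^+ 2 by rewrite mulr_ge0 ?sqr_ge0// (le_trans ler01).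
have sq (x g : R) : 0 <= x -> x ^+ 2 <= g * tau ^+ 4 -> g <= M ^+ 2 -> x <= M * tau ^+ 2.
  move=> x0 h gM; rewrite -(@ler_pXn2r _ 2)// ?nnegrE//.
  apply: le_trans h _.
  rewrite (_ : (M * tau ^+ 2) ^+ 2 = M ^+ 2 * tau ^+ 4); last by ring.
  by rewrite ler_wpM2r.
by split; apply: sq; first [exact: normr_ge0 | eassumption].
Qed.

End Stability.

(** * Error equations of the scheme *)

Section SchemeAlgebra.
Context {R : realType} {V H Q : hilbertType R}.
Variables (iota : clin V H) (A : clin V (dual V)) (B : clin V (dual Q)).
Variables (D : clin H (dual V)) (Bm : clin (dual Q) V) (DV : clin V (dual H)).
Hypotheses (hDV : forall v, D (iota v) = restr iota (DV v))
  (hD : forall v, 0 <= DV v (iota v)).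
Hypothesis hproj : projection_uniquely_solvable iota B Bm.

(** The zero set of [phi1 - phi2] is closed, so with the image of the kernel it contains the closure
    [Hker]. *)
Lemma Hker_functional_eq (phi1 phi2 : dual H) :
  (forall v, Vker B v -> phi1 (iota v) = phi2 (iota v)) ->
  forall h, Hker iota B h -> phi1 h = phi2 h.
Proof.
move=> phi12 h hh; apply/eqP; rewrite -subr_eq0; apply/eqP.
have cl : closed ((phi1 - phi2 : dual H) @^-1` [set 0]).
  apply: closed_comp; last exact: (@closed_eq (R^o : normedModType R)).
  by move=> x _; exact: clin_continuous.
move: hh; rewrite /Hker closureE => /(smallest_sub cl); apply => _ [v kv <-] /=.
by rewrite -[LHS]/(phi1 (iota v) - phi2 (iota v)) phi12// subrr.
Qed.

Lemma rieszE (h k : H) : riesz h k = hdot h k.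
Proof. by []. Qed.

Lemma to_dualE h v : to_dual iota h v = hdot h (iota v).
Proof. by []. Qed.

Lemma restrE (phi : dual H) v : restr iota phi v = phi (iota v).
Proof. by []. Qed.

Lemma adjoint_Vker v q : Vker B v -> adjoint B q v = 0.
Proof. by rewrite /Vker /= => kv; rewrite -[LHS]/(B v q) kv. Qed.

(** With constraint data [0] the projection system yields [w] in [Hker], and its multiplier vanishes
    on [Vker]; hence [w] is the orthogonal projection of [h]. *)
Lemma Hker_projection (h : H) : exists p : H, Hker iota B p /\
  forall k, Hker iota B k -> hdot p k = hdot h k.
Proof.
have [[w mu] [[/= [h' kh' wE] E] _]] := hproj (riesz h) 0.
exists w; split; first by rewrite wE clin_arg0 clin_arg0 addr0.
apply: (@Hker_functional_eq (riesz w) (riesz h)) => v kv.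
have := congr1 (fun phi : dual V => phi v) E.
by rewrite clinD adjoint_Vker// addr0.
Qed.

(** Two half steps from the same data differ by some [d] in the kernel. Testing with [d] leaves a
    vanishing sum of nonnegative terms, and the coercive one forces [d = 0]. The third substep is
    unique by [hproj]. *)
Lemma imex_scheme_unique (f : R -> H -> dual H) (g : R -> dual Q) (tau a : R)
    (N : nat) (u0 : V) (w0 : H) u w u' w' :
  0 < tau -> 0 < a -> (forall v, Vker B v -> a * `|v| ^+ 2 <= A v v) ->
  imex_scheme iota A B D Bm f g tau N u0 w0 u w ->
  imex_scheme iota A B D Bm f g tau N u0 w0 u' w' ->
  forall n, (n <= N)%N -> u n = u' n /\ w n = w' n.
Proof.
move=> tau0 a0 hA [u00 w00 st] [u'0 w'0 st']; elim=> [_|n IHn nN].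
  by rewrite u00 w00.
have [un wn] := IHn (ltnW nN).
have [wh [l [mu [E1 E2 E3 E4]]]] := st n nN.
have [wh' [l' [mu' [E1' E2' E3' E4']]]] := st' n nN.
rewrite -un -wn in E1' E3' E4'.
have kd : Vker B (wh - wh') by rewrite /Vker /= clin_argB E2 E2' subrr.
have whE : wh = wh'.
  apply/eqP; rewrite -subr_eq0 -normr_eq0 -sqrf_eq0 eq_le sqr_ge0 andbT.
  set d := wh - wh' in kd *.
  have := congr1 (fun phi : dual V => phi d) (etrans E1 (esym E1')).
  rewrite !clinD !dualZ !adjoint_Vker// !hDV.
  rewrite !to_dualE => Ed.
  have : hdot (iota d) (iota d) + tau / 2 * DV d (iota d) + tau ^+ 2 / 4 * A d d = 0.
    have -> : hdot (iota d) (iota d) = hdot (iota wh) (iota d) - hdot (iota wh') (iota d).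
      by rewrite -hdotBl -clin_argB.
    have -> : DV d (iota d) = DV wh (iota d) - DV wh' (iota d).
      by rewrite -clinB -clin_argB.
    have -> : A d d = A wh d - A wh' d by rewrite -clinB -clin_argB.
    by move: Ed; rewrite !restrE; lra.
  have Ad := hA _ kd; rewrite hdot_norm => Ed0.
  have t2 : 0 < tau ^+ 2 / 4 by rewrite divr_gt0// exprn_gt0.
  have k1 : tau ^+ 2 / 4 * (a * `|d| ^+ 2) <= tau ^+ 2 / 4 * A d d.
    by rewrite ler_wpM2l// ltW.
  have k2 : 0 <= tau / 2 * DV d (iota d) by rewrite mulr_ge0// divr_ge0// ltW.
  have k3 : 0 <= `|iota d| ^+ 2 by exact: sqr_ge0.
  have : tau ^+ 2 / 4 * (a * `|d| ^+ 2) <= 0 by lra.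
  by rewrite pmulr_rle0// pmulr_rle0.
have uE : u n.+1 = u' n.+1 by rewrite E3 E3' whE.
split=> //; rewrite whE uE in E4.
have [p [_ pU]] := hproj
  (riesz (2 *: iota wh' - w n) + (tau / 2) *: (f (n.+1%:R * tau) (iota (u' n.+1)) -
     f (n%:R * tau) (iota (u n))))
  (tau^-1 *: (g ((n%:R + 3 / 2) * tau) - g ((n%:R + 1 / 2) * tau))).
have p1 := pU (w n.+1, mu) E4; have p2 := pU (w' n.+1, mu') E4'.
by have [-> _] : (w n.+1, mu) = (w' n.+1, mu') by rewrite -p1 -p2.
Qed.

Lemma riesz_norm_le (h : H) : `|riesz h| <= `|h|.
Proof. by apply: clin_norm_lub => // x; exact: cauchy_schwarz. Qed.

(** The indices [0] and [1] mark the ends of the step: [u], [v], [a], [x] are exact position,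
    velocity, acceleration and nonlinearity; [n], [w], [f] are numerical position, velocity and
    nonlinearity. On the kernel the substeps combine to [w1 - w0 = - tau D wh - tau / 2 A (n0 + n1)
    + tau / 2 (f0 + f1)], which is compared with the trapezoidal rule for the exact equation. *)
Lemma error_step_of_imex (K tau : R) (u0 u1 v0 v1 a0 a1 n0 n1 wh : V)
    (x0 x1 psi0 psi1 w0 w1 s0 s1 : H) (l0 l1 l mu : Q) (f0 f1 : dual H) :
  0 < tau -> 0 <= K ->
  to_dual iota (iota a0) + D (iota v0) + A u0 + adjoint B l0 = restr iota (riesz x0) ->
  to_dual iota (iota a1) + D (iota v1) + A u1 + adjoint B l1 = restr iota (riesz x1) ->
  to_dual iota (iota wh) + (tau / 2) *: D (iota wh) + (tau ^+ 2 / 4) *: A wh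
    + (tau / 2) *: adjoint B l
    = to_dual iota w0 - (tau / 2) *: A n0 + (tau / 2) *: restr iota f0 ->
  n1 = n0 + tau *: wh -> Vker B (u1 - u0 - tau *: wh) ->
  to_dual iota w1 + adjoint B mu =
    restr iota (riesz (2 *: iota wh - w0) + (tau / 2) *: (f1 - f0)) ->
  (forall k, Hker iota B k -> hdot s0 k = hdot (iota v0 - w0 - tau ^+ 2 *: psi0) k) ->
  (forall k, Hker iota B k -> hdot s1 k = hdot (iota v1 - w1 - tau ^+ 2 *: psi1) k) ->
  `|u1 - u0 - (tau / 2) *: (v0 + v1)| <= K * tau ^+ 3 ->
  `|iota v1 - iota v0 - (tau / 2) *: (iota a0 + iota a1)| <= K * tau ^+ 3 ->
  `|tau *: (iota v1 + iota v0) - 2 *: (iota u1 - iota u0)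
    - (tau ^+ 2 / 2) *: (x1 - x0) - tau ^+ 3 *: (psi0 + psi1)| <= K * tau ^+ 4 ->
  `|psi1 - psi0| <= K * tau ->
  error_step iota B A DV ((`|DV| + 2) * K) tau (u0 - n0) (u1 - n1) s0 s1
    (riesz x0 - f0) (riesz x1 - f1).
Proof.
move=> tau0 K0 X0 X1 S1 n1E kd S3 hs0 hs1 bV bH bD bpsi.
have tn0 : tau != 0 by rewrite gt_eqF.
pose eta := tau^-1 *: (u1 - u0 - tau *: wh).
have etaE : tau *: eta = u1 - u0 - tau *: wh by rewrite scalerA divff// scale1r.
pose trV := u1 - u0 - (tau / 2) *: (v0 + v1).
pose trH := iota v1 - iota v0 - (tau / 2) *: (iota a0 + iota a1).
pose df := tau *: (iota v1 + iota v0) - 2 *: (iota u1 - iota u0)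
    - (tau ^+ 2 / 2) *: (x1 - x0) - tau ^+ 3 *: (psi0 + psi1).
have S3' h : Hker iota B h ->
    hdot w1 h = 2 * hdot (iota wh) h - hdot w0 h + tau / 2 * (f1 h - f0 h).
  move=> hh; transitivity ((riesz (2 *: iota wh - w0) + (tau / 2) *: (f1 - f0)) h).
    apply: (Hker_functional_eq (phi1 := riesz w1)) hh => v kv.
    have := congr1 (fun phi : dual V => phi v) S3.
    by rewrite clinD adjoint_Vker// addr0.
  by rewrite clinD dualZ clinB rieszE !hdotE.
have tau3 : 0 <= tau ^+ 3 by rewrite exprn_ge0// ltW.
have KT3 : 0 <= K * tau ^+ 3 by rewrite mulr_ge0.
(* [DV trV] appears because the damping acts on [eta], built from the difference quotient of [u],
   while the exact equation contains averaged velocities. *)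
exists eta, (riesz (trH - tau ^+ 2 *: (psi1 - psi0)) + DV trV), (riesz (tau^-1 *: df)).
split.
- by move: kd; rewrite /Vker /= => kd; rewrite clin_argZ kd scaler0.
- by rewrite etaE n1E; apply: hdot_inj => z; rewrite !hdotE; ring.
- move=> v kv; have kiv : Hker iota B (iota v) by exact: Hker_iota.
  have eX0 := congr1 (fun phi : dual V => phi v) X0.
  have eX1 := congr1 (fun phi : dual V => phi v) X1.
  have eS1 := congr1 (fun phi : dual V => phi v) S1.
  have etaD : tau * DV eta (iota v) =
      DV u1 (iota v) - DV u0 (iota v) - tau * DV wh (iota v).
    by rewrite -dualZ -clin_argZ etaE !clin_argB clin_argZ !clinB.
  move: eX0 eX1 eS1 (S3' _ kiv); rewrite !(clinD, clinN, dualZ) !adjoint_Vker// !hDV.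
  rewrite !to_dualE !restrE ?rieszE !addr0 => eX0 eX1 eS1 eS3.
  rewrite etaD hdotBl (hs0 _ kiv) (hs1 _ kiv) /trV /trH n1E.
  rewrite !(clin_argD, clin_argB, clin_argZ, clinD, clinB, clin_argN, clinN, dualZ,
    rieszE, hdotE).
  (* After this scaling the claim is a combination of the equations with numerical coefficients. *)
  have mX0 := congr1 (fun z => tau * z) eX0; have mX1 := congr1 (fun z => tau * z) eX1.
  move: mX0 mX1 => /= mX0 mX1; lra.
- move=> h kh; rewrite !hdotE (hs0 _ kh) (hs1 _ kh) !hdotE (S3' _ kh) !clin_argZ /df.
  rewrite !(clin_argB, clin_argZ, clinD, clinB, clin_argN, clinN, dualZ, rieszE, hdotE).
  by field.
split.
  apply: le_trans (ler_normD _ _) _; rewrite mulrDl mulrDl addrC.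
  have DVt : `|DV trV| <= `|DV| * K * tau ^+ 3.
    by apply: le_trans (clin_le _ _) _; rewrite -mulrA ler_wpM2l.
  rewrite lerD//; apply: le_trans (riesz_norm_le _) _.
  apply: le_trans (ler_normB _ _) _.
  have : `|tau ^+ 2 *: (psi1 - psi0)| <= K * tau ^+ 3.
    rewrite normrZ ger0_norm ?sqr_ge0//.
    rewrite (_ : K * tau ^+ 3 = tau ^+ 2 * (K * tau)); last by ring.
    by rewrite ler_wpM2l ?sqr_ge0.
  by move: bH; rewrite -/trH; lra.
apply: le_trans (riesz_norm_le _) _; rewrite normrZ gtr0_norm ?invr_gt0//.
rewrite ler_pdivrMl//; apply: le_trans bD _.
rewrite (_ : tau * _ = (`|DV| + 2) * (K * tau ^+ 4)); last by ring.
have : 0 <= `|DV| by [].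
have : 0 <= K * tau ^+ 4 by rewrite mulr_ge0// exprn_ge0// ltW.
by move=> k1 k2; rewrite ler_peMl//; lra.
Qed.

End SchemeAlgebra.

(** * Consistency of the exact solution *)

Lemma derive_within_constraint {R : realType} (V W : normedModType R)
    (B : clin V W) (T S : R) (u : R -> V) (g : R -> W) t :
  0 < T -> T <= S -> `[0, T]%classic t ->
  cvg (diff_quot_within `[0, T] u t) -> cvg (diff_quot_within `[0, S] g t) ->
  (forall s, `[0, T]%classic s -> B (u s) = g s) ->
  B (derive_within `[0, T] u t) = derive_within `[0, S] g t.
Proof.
move=> T0 TS Tt cu cg Bu.
have ? := within_itv_dnbhs_proper T0 Tt.
have h1 : diff_quot_within `[0, T] g t --> B (derive_within `[0, T] u t).
  rewrite -(@eq_diff_quot_within _ _ _ (B \o u))//; exact: diff_quot_clin.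
(* [g] is differentiated on the longer interval; its quotient on [[0, T]] runs along a finer filter
   and has the same limit, also at [t = T]. *)
have h2 : diff_quot_within `[0, T] g t --> derive_within `[0, S] g t.
  move=> P /cg; rewrite /diff_quot_within /fmap /= /within /=.
  apply: (@filterS _ t^') => s + Ts; apply.
  by move: Ts; rewrite /= !in_itv/= => /andP[-> /le_trans]; apply.
by rewrite -(cvg_lim (@norm_hausdorff _ _) h1) (cvg_lim (@norm_hausdorff _ _) h2).
Qed.

Lemma exact_solution_consistency {R : realType} (V H Q : hilbertType R)
    (iota : clin V H) (B : clin V (dual Q)) (Bm : clin (dual Q) V) (T : R)
    (u : R -> V) (F : R -> H) (g : R -> dual Q) :
  0 < T -> Ck_on 3 `[0, T] u -> Ck_on 4 `[0, T] (iota \o u) -> Ck_on 2 `[0, T] F ->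
  Ck_on 3 `[0, T + T / 2] g -> (forall t, `[0, T]%classic t -> B (u t) = g t) ->
  let v := derive_within `[0, T] u in
  let w := derive_within `[0, T] v in
  exists2 K : R, 0 <= K & exists psi : R -> H,
  [/\ forall t, 0 <= t <= T -> `|u t| <= K /\ `|psi t| <= K,
      forall t tau, 0 <= t -> 0 <= tau -> t + tau <= T ->
      [/\ `|u (t + tau) - u t - (tau / 2) *: (v t + v (t + tau))| <= K * tau ^+ 3,
        `|iota (v (t + tau)) - iota (v t)
          - (tau / 2) *: (iota (w t) + iota (w (t + tau)))|
          <= K * tau ^+ 3,
        `|tau *: (iota (v (t + tau)) + iota (v t))
          - 2 *: (iota (u (t + tau)) - iota (u t))
          - (tau ^+ 2 / 2) *: (F (t + tau) - F t)
          - tau ^+ 3 *: (psi t + psi (t + tau))| <= K * tau ^+ 4 &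
        `|psi (t + tau) - psi t| <= K * tau] &
      forall t tau, 0 < tau <= T -> 0 <= t - tau / 2 -> t <= T ->
        `|Bm (B (v t)) - tau^-1 *: (Bm (g (t + tau / 2)) - Bm (g (t - tau / 2)))|
          <= K * tau ^+ 2].
Proof.
move=> T0 cV cH cF cG Bu v w; pose S := T + T / 2.
have TS : T <= S by rewrite /S lerDl divr_ge0// ltW.
have S0 : 0 < S by exact: lt_le_trans TS.
pose hV j := iter j (derive_within `[0, T]) u.
pose hH j := iter j (derive_within `[0, T]) (iota \o u).
pose hF j := iter j (derive_within `[0, T]) F.
pose hG j t := Bm (iter j (derive_within `[0, S]) g t).
have dV : derivatives_on T 3 hV by move=> j t; exact: Ck_on_diff_quot.
have dH : derivatives_on T 4 hH by move=> j t; exact: Ck_on_diff_quot.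
have dF : derivatives_on T 2 hF by move=> j t; exact: Ck_on_diff_quot.
have dG : derivatives_on S 3 hG.
  by move=> j t j3 St; apply: (diff_quot_clin (L := Bm)); exact: (Ck_on_diff_quot cG).
have [MV bV] := Ck_on_bounded T0 cV (leqnn 3).
have [Mu bu] := Ck_on_bounded T0 cV (leq0n 3).
have [MH bH] := Ck_on_bounded T0 cH (leqnn 4).
have [MH3 bH3] := Ck_on_bounded T0 cH (leqnSn 3).
have [MF bF] := Ck_on_bounded T0 cF (leqnn 2).
have [MF1 bF1] := Ck_on_bounded T0 cF (leqnSn 1).
have [MG bG] := Ck_on_bounded S0 cG (leqnn 3).
have MV0 : 0 <= MV := bounded_by_ge0 T0 bV.
have Mu0 : 0 <= Mu := bounded_by_ge0 T0 bu.
have MH0 : 0 <= MH := bounded_by_ge0 T0 bH.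
have MH30 : 0 <= MH3 := bounded_by_ge0 T0 bH3.
have MF0 : 0 <= MF := bounded_by_ge0 T0 bF.
have MF10 : 0 <= MF1 := bounded_by_ge0 T0 bF1.
have bG' : bounded_by S (`|Bm| * MG) (hG 3%N).
  by move=> t St; apply: le_trans (clin_le _ _) _; rewrite ler_wpM2l//; exact: bG.
have MG0 : 0 <= `|Bm| * MG := bounded_by_ge0 S0 bG'.
have hHE j t : (j <= 3)%N -> 0 <= t <= T -> hH j t = iota (hV j t).
  by move=> j3 tT; exact: (iter_derive_within_clin _ T0 cV).
set G := `|Bm| * MG in MG0 bG'.
(* The largest factor among the truncation bounds is [5]. *)
pose K := 5 * (MV + Mu + MH + MH3 + MF + MF1 + G).
exists K; first by rewrite /K mulr_ge0// !addr_ge0.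
have leK (m x p : R) : m <= K -> 0 <= p -> x <= m * p -> x <= K * p.
  by move=> mK p0 /le_trans; apply; rewrite ler_wpM2r.
exists (half_step_corrector hH hF); split.
- move=> t tT; split.
    by apply: le_trans (bu t tT) _; rewrite /K; lra.
  apply: le_trans (ler_normB _ _) _; rewrite !normrZ !ger0_norm ?invr_ge0//.
  by have := bH3 t tT; have := bF1 t tT; rewrite -/(hF _) -/(hH _) /K; lra.
- move=> t tau t0 tau0 ttau.
  have tT : 0 <= t <= T by rewrite t0 (le_trans _ ttau)// lerDl.
  have ttT : 0 <= t + tau <= T by rewrite addr_ge0.
  have p3 : 0 <= tau ^+ 3 by exact: exprn_ge0.
  have p4 : 0 <= tau ^+ 4 by exact: exprn_ge0.
  split.
  + apply: (leK (2 * MV)) => //; first by rewrite /K; lra.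
    exact: (trapezoid_le tau0 t0 ttau dV bV MV0).
  + have := trapezoid_le tau0 t0 ttau (derivatives_on_shift (m := 1) dH) bH MH0.
    rewrite !hHE// => h; apply: (leK (2 * MH)) => //.
    by rewrite /K; lra.
  + have MHF0 : 0 <= MH + MF by exact: addr_ge0.
    have bH' : bounded_by T (MH + MF) (hH 4%N).
      by move=> s sT; apply: le_trans (bH s sT) _; rewrite lerDl.
    have bF' : bounded_by T (MH + MF) (hF 2%N).
      by move=> s sT; apply: le_trans (bF s sT) _; rewrite lerDr.
    have := half_step_defect_le MHF0 dH bH' dF bF' tau0 t0 ttau.
    rewrite (hHE 1%N)// (hHE 1%N)// => h; apply: (leK (5 * (MH + MF))) => //.
    by rewrite /K; lra.
  + have MHF0 : 0 <= MH + MF by exact: addr_ge0.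
    have bH' : bounded_by T (MH + MF) (hH 4%N).
      by move=> s sT; apply: le_trans (bH s sT) _; rewrite lerDl.
    have bF' : bounded_by T (MH + MF) (hF 2%N).
      by move=> s sT; apply: le_trans (bF s sT) _; rewrite lerDr.
    apply: (leK (MH + MF)) => //; first by rewrite /K; lra.
    exact: (half_step_corrector_lip MHF0 dH bH' dF bF' tau0 t0 ttau).
- move=> t tau /andP[tau0 tauT] t0 tT.
  have tT' : 0 <= t <= T by rewrite tT andbT; apply: le_trans t0 _;
    rewrite lerBlDr lerDl divr_ge0// ltW.
  have tS : t + tau / 2 <= S by rewrite /S lerD// ler_wpM2r.
  have := midpoint_le tau0 t0 tS dG bG' MG0.
  have -> : hG 1%N t = Bm (B (v t)).
    rewrite /hG /=; congr (Bm _); apply/esym.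
    apply: (derive_within_constraint T0 TS tT') => //.
      by apply/cvg_ex; eexists; exact: (@Ck_on_diff_quot _ _ _ _ _ cV 0).
    apply/cvg_ex; eexists; apply: (@Ck_on_diff_quot _ _ _ _ _ cG 0) => //=.
    by move: tT'; rewrite in_itv/= => /andP[-> /le_trans]; apply.
  by move=> h; apply: (leK (2 * G)); rewrite ?sqr_ge0//; rewrite /K; lra.
Qed.

(** Each of the finitely many pairs [(N, n)] admits at most one value, so the sum of their positive
    parts is a bound. [E] is a relation because a numerical solution need not exist; a missing value
    counts as [0]. *)
Lemma bounded_error_few_steps {R : realType} (E : nat -> nat -> R -> Prop) (N0 : nat) :
  (forall N n x y, E N n x -> E N n y -> x = y) ->
  exists2 C : R, 0 <= C & forall N n x, (N < N0)%N -> (n <= N)%N -> E N n x -> x <= C.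
Proof.
move=> EU.
have one (p : nat * nat) :
    exists c : R, 0 <= c /\ forall x, E p.1 p.2 x -> x <= c.
  have [[x Ex]|nE] := pselect (exists x, E p.1 p.2 x).
    exists (Num.max 0 x); split; first by rewrite le_max lexx.
    by move=> y /EU /(_ Ex) ->; rewrite le_max lexx orbT.
  by exists 0; split=> // x Ex; case: nE; exists x.
have [c' hc] := choice one; pose c N n := c' (N, n).
have c0 N n : 0 <= c N n by have [] := hc (N, n).
have cP N n x : E N n x -> x <= c N n by have [_] := hc (N, n); apply.
exists (\sum_(N < N0) \sum_(n < N.+1) c N n).
  by apply: sumr_ge0 => N _; exact: sumr_ge0.
move=> N n x NN0 nN /cP; move/le_trans; apply.
rewrite (bigD1 (Ordinal NN0))//= (bigD1 (Ordinal (nN : (n < N.+1)%N)))//= -addrA lerDl.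
apply: addr_ge0; apply: sumr_ge0 => m _; first exact: c0.
by apply: sumr_ge0 => k _; exact: c0.
Qed.

(** * Second-order convergence: small step sizes, then the finitely many large ones *)

Theorem theorem3p6 (R : realType) (V H Q : hilbertType R)
  (iota : clin V H) (hiota : gelfand_embedding iota)
  (B : clin V (dual Q))
  (hB : exists2 beta : R, 0 < beta & inf_sup_ge B beta)
  (A A1 : clin V (dual V)) (A2 : clin V (dual H))
  (hA : elliptic_on_Vker B A)
  (hA12 : forall v, A v = A1 v + restr iota (A2 v))
  (hA1sym : forall v w, A1 v w = A1 w v)
  (hA1 : elliptic_on_Vker B A1)
  (Bm : clin (dual Q) V) (hBm : is_right_inverse_onto_Vc A B Bm)
  (D : clin H (dual V)) (DV : clin V (dual H))
  (hDV : forall v, D (iota v) = restr iota (DV v))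
  (hD : forall v, 0 <= DV v (iota v))
  (hproj : projection_uniquely_solvable iota B Bm)
  (T : R) (hT : 0 < T)
  (f : R -> H -> dual H) (hfC : caratheodory `[0, T] f)
  (hfL : forall rho : R, exists L : R, forall t, t \in `[0, T] ->
     forall v1 v2 : V, `|v1| <= rho -> `|v2| <= rho ->
       `|f t (iota v1) - f t (iota v2)| <= L * `|v1 - v2|)
  (g : R -> dual Q)
  (* The last step evaluates g at T + tau / 2, at most T + T / 2. *)
  (hg : Ck_on 4 `[0, T + T / 2] g)
  (u0ker w0ker u0 w0 : V)
  (hu0ker : dom_Aker iota A B u0ker) (hw0ker : Vker B w0ker)
  (hu0 : u0 = u0ker + Bm (g 0))
  (hw0 : w0 = w0ker + Bm (derive_within `[0, T] g 0))
  (u : R -> V) (lambda : R -> Q)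
  (hsol : pdae_solution iota A B D f g T u0 w0 u lambda)
  (huV : Ck_on 3 `[0, T] u) (huH : Ck_on 4 `[0, T] (iota \o u))
  (hfu : exists2 F : R -> H, Ck_on 2 `[0, T] F &
     forall t, t \in `[0, T] -> f t (iota (u t)) = riesz (F t)) :
  exists2 C : R, 0 < C &
    forall N : nat, (0 < N)%N ->
    forall (un : nat -> V) (wn : nat -> H),
      let tau := T / N%:R in
      imex_scheme iota A B D Bm f g tau N u0 (iota w0) un wn ->
    forall n : nat, (n <= N)%N ->
      let tn := n%:R * tau in
      `|u tn - un n| + `|iota (derive_within `[0, T] u tn) - wn n|
        <= C * tau ^+ 2.
Proof.
have [u00 v00 sol] := hsol; set v := derive_within `[0, T] u in v00 sol *.
set w := derive_within `[0, T] v in sol.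
have [a1 a10 ha1] := hA; have [a2 a20 ha2] := hA1.
pose a := Num.min a1 a2.
have a0 : 0 < a by rewrite lt_min a10.
have hAa x : Vker B x -> a * `|x| ^+ 2 <= A x x.
  by move=> kx; apply: le_trans (ha1 x kx); rewrite ler_wpM2r ?sqr_ge0// ge_min lexx.
have hA1a x : Vker B x -> a * `|x| ^+ 2 <= A1 x x.
  by move=> kx; apply: le_trans (ha2 x kx); rewrite ler_wpM2r ?sqr_ge0// ge_min lexx orbT.
have [F cF hF] := hfu.
have Bu t : `[0, T]%classic t -> B (u t) = g t by move=> tT; have [] := sol t tT.
have hg3 : Ck_on 3 `[0, T + T / 2] g by exact: Ck_onW hg.
have [K0 K00 [psi [bnd cons consg]]] :=
  exact_solution_consistency Bm hT huV huH cF hg3 Bu.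
rewrite -/v -/w in cons consg.
(* The exact solution is bounded by [K0], so errors up to [1] keep the numerical one in this
   ball. *)
have [L0 hL0] := hfL (K0 + 1).
pose L := `|L0|; pose K := (`|DV| + 2) * K0.
have L_ge0 : 0 <= L by exact: normr_ge0.
have K_ge0 : 0 <= K by rewrite mulr_ge0// addr_ge0.
have K0K : K0 <= K by rewrite /K ler_peMl// -[leLHS]add0r lerD// ler1n.
have [tau0 tau00 [M M0 stab]] := stability hA12 hA1sym hD a0 L_ge0 K_ge0 hT hAa hA1a.
have [P hP] := choice (Hker_projection hproj).
(* The first [M] is for the position. The velocity error is split below into [r], [s] and [c],
   bounded by [K0 + |iota| K0], [M] and [|iota| K0] times [tau ^ 2]. *)
pose C1 := M + (M + K0 + 2 * (`|iota| * K0)).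
have C10 : 0 <= C1 by rewrite /C1 !addr_ge0// !mulr_ge0.
have small N : (0 < N)%N -> T / N%:R <= tau0 -> forall un wn,
    let tau := T / N%:R in
    imex_scheme iota A B D Bm f g tau N u0 (iota w0) un wn ->
    forall n, (n <= N)%N -> `|u (n%:R * tau) - un n|
      + `|iota (v (n%:R * tau)) - wn n| <= C1 * tau ^+ 2.
  move=> N0; set tau := T / N%:R => tautau0 un wn tau' [un0 wn0 st].
  rewrite /tau' -/tau in st *; move=> {tau'}.
  have Nn0 : (N%:R : R) != 0 by rewrite pnatr_eq0 -lt0n.
  have NT : N%:R * tau = T by rewrite /tau mulrC divfK.
  have tau_gt0 : 0 < tau by rewrite divr_gt0// ltr0n.
  have tauT : tau <= T by rewrite ler_pdivrMr ?ltr0n// ler_peMr ?ler1n// ltW.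
  have tS n : n.+1%:R * tau = n%:R * tau + tau by rewrite -natr1 mulrDl mul1r.
  have tn n : (n <= N)%N -> 0 <= n%:R * tau <= T.
    move=> nN; rewrite mulr_ge0 ?(ltW tau_gt0)//= -NT.
    by rewrite ler_wpM2r ?(ltW tau_gt0)// ler_nat.
  have tn_in n : (n <= N)%N -> n%:R * tau \in `[0, T] by move=> /tn nT; rewrite in_itv.
  have Bun n : (n <= N)%N -> B (un n) = g (n%:R * tau).
    elim: n => [_|n IHn nN].
      by rewrite un0 -u00 mul0r -Bu//= in_itv/= lexx ltW.
    have [wh [l [mu [_ E2 E3 _]]]] := st n nN.
    rewrite E3 clin_argD clin_argZ E2 scalerA divff ?gt_eqF// scale1r IHn ?(ltnW nN)//.
    by rewrite addrC subrK.
  pose e n := u (n%:R * tau) - un n.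
  pose d n := iota (v (n%:R * tau)) - wn n.
  pose s n := P (d n - tau ^+ 2 *: psi (n%:R * tau)).
  pose Fn n := riesz (F (n%:R * tau)) - f (n%:R * tau) (iota (un n)).
  have ke n : (n <= N)%N -> Vker B (e n).
    by move=> nN; rewrite /Vker /= clin_argB Bun// Bu ?subrr//; exact: tn.
  have d0 : d 0%N = 0 by rewrite /d wn0 mul0r; rewrite v00 subrr.
  have sP n k : Hker iota B k ->
      hdot (s n) k = hdot (d n - tau ^+ 2 *: psi (n%:R * tau)) k.
    by move=> kk; have [_] := hP (d n - tau ^+ 2 *: psi (n%:R * tau)); apply.
  have ks n : Hker iota B (s n) by have [] := hP (d n - tau ^+ 2 *: psi (n%:R * tau)).
  have psiK n : (n <= N)%N -> `|tau ^+ 2 *: psi (n%:R * tau)| <= K0 * tau ^+ 2.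
    move=> nN; rewrite normrZ ger0_norm ?sqr_ge0// mulrC ler_wpM2r ?sqr_ge0//.
    by have [] := bnd _ (tn n nN).
  (* The initial error vanishes; what remains is the projected corrector, and projecting does not
     increase the norm. *)
  have s0 : `|s 0%N| <= K * tau ^+ 2.
    apply: (@le_trans _ _ (K0 * tau ^+ 2)); last by rewrite ler_wpM2r ?sqr_ge0.
    apply: norm_le_of_hdot; last by rewrite mulr_ge0 ?sqr_ge0.
    rewrite (sP 0%N _ (ks 0%N)) d0 sub0r; apply: le_trans (hdot_le _ _) _.
    by rewrite normrN ler_wpM2r// psiK.
  have lip n : (n <= N)%N -> `|e n| <= 1 -> `|Fn n| <= L * `|e n|.
    move=> nN en; rewrite /Fn -hF ?tn_in//.
    have [un1 _] := bnd _ (tn n nN).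
    have un2 : `|un n| <= K0 + 1.
      rewrite -[un n](subKr (u (n%:R * tau))).
      by apply: le_trans (ler_normB _ _) _; rewrite lerD.
    apply: le_trans (hL0 _ (tn_in n nN) _ _ _ un2) _.
      by apply: le_trans un1 _; rewrite lerDl.
    by rewrite ler_wpM2r// ler_norm.
  have step n : (n < N)%N ->
      error_step iota B A DV K tau (e n) (e n.+1) (s n) (s n.+1) (Fn n) (Fn n.+1).
    move=> nN; have nN' := ltnW nN.
    have [wh [l [mu [E1 E2 E3 [_ E4]]]]] := st n nN.
    have [X0 _] := sol _ (tn_in n nN'); have [X1 _] := sol _ (tn_in n.+1 nN).
    rewrite hF ?tn_in// in X0; rewrite hF ?tn_in// in X1.
    have /andP[t0 _] := tn n nN'; have /andP[_ t1] := tn n.+1 nN.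
    rewrite tS in t1; have [c1 c2 c3 c4] := cons _ _ t0 (ltW tau_gt0) t1.
    rewrite -tS in c1 c2 c3 c4.
    apply: (error_step_of_imex hDV tau_gt0 K00 X0 X1 E1 E3 _ E4 (sP n) (sP n.+1)
      c1 c2 c3 c4).
    rewrite /Vker /= !clin_argB clin_argZ E2 !Bu; [|exact: tn..].
    by rewrite scalerA divff ?gt_eqF// scale1r subrr.
  have taus : 0 < tau <= tau0 by rewrite tau_gt0.
  have e0 : e 0%N = 0 by rewrite /e un0 mul0r u00 subrr.
  have kes n : (n <= N)%N -> Vker B (e n) /\ Hker iota B (s n).
    by move=> nN; split; [exact: ke|exact: ks].
  move=> n nN; have [en sn] := stab tau N e s Fn taus NT e0 s0 kes lip step n nN.
  rewrite /C1 mulrDl; apply: lerD => //; rewrite -/(d n).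
  have C20 : 0 <= (M + K0 + 2 * (`|iota| * K0)) * tau ^+ 2.
    by rewrite mulr_ge0 ?sqr_ge0// !addr_ge0// !mulr_ge0.
  (* The initial velocity is exact; from index [1] on the third substep splits [wn] into a part in
     [Hker] and an image of [Bm]. *)
  case: n nN en sn => [|n] nN _ sn; first by rewrite d0 normr0.
  have [wh [l [mu [_ _ _ [[h kh wE] _]]]]] := st n nN.
  have /andP[_ t1] := tn n.+1 nN; set t := n.+1%:R * tau in t1.
  have tE1 : (n%:R + 3 / 2) * tau = t + tau / 2 by rewrite /t -natr1; field.
  have tE2 : (n%:R + 1 / 2) * tau = t - tau / 2 by rewrite /t -natr1; field.
  rewrite tE1 tE2 clin_argZ clin_argB in wE.
  (* The midpoint-rule error in the complement; removing it from the velocity error leaves an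
     element of [Hker]. *)
  pose c := iota (Bm (B (v t)) - tau^-1 *: (Bm (g (t + tau / 2)) - Bm (g (t - tau / 2)))).
  have cK : `|c| <= `|iota| * K0 * tau ^+ 2.
    apply: le_trans (clin_le _ _) _; rewrite -mulrA ler_wpM2l//.
    apply: consg => //; first by rewrite tau_gt0.
    by rewrite -tE2; apply: mulr_ge0 (ltW tau_gt0); rewrite addr_ge0 ?divr_ge0.
  have dc : d n.+1 - c = iota (v t - Bm (B (v t))) - h.
    rewrite /d wE /c -/t !clin_argB; apply: hdot_inj => z; rewrite !hdotE; ring.
  have kv : Hker iota B (iota (v t - Bm (B (v t)))).
    by apply: Hker_iota; rewrite /Vker /= clin_argB (hBm.1 (B (v t))) subrr.
  have dcP k : Hker iota B k -> hdot (s n.+1) k = hdot (d n.+1 - tau ^+ 2 *: psi t) k.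
    exact: sP.
  (* [r] lies in [Hker], where it acts like [tau ^ 2 psi - c] because [s] is a projection. Testing
     [r] with itself bounds it. *)
  pose r := d n.+1 - c - s n.+1.
  have rK : `|r| <= K0 * tau ^+ 2 + `|iota| * K0 * tau ^+ 2.
    apply: norm_le_of_hdot; last first.
      by rewrite -mulrDl mulr_ge0 ?sqr_ge0// addr_ge0// mulr_ge0.
    have rk k : Hker iota B k -> hdot k r = hdot k (tau ^+ 2 *: psi t - c).
      move=> kk; rewrite ![hdot k _]hdotC /r !hdotBl (dcP _ kk) !hdotBl; ring.
    have -> : hdot r r = hdot r (tau ^+ 2 *: psi t - c).
      rewrite {1 3}/r dc !hdotBl; by rewrite !rk//; exact: ks.
    apply: le_trans (hdot_le _ _) _; rewrite mulrC ler_wpM2r//.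
    apply: le_trans (ler_normB _ _) _; apply: lerD => //.
    exact: psiK.
  have -> : d n.+1 = r + s n.+1 + c by rewrite /r subrK subrK.
  apply: le_trans (ler_normD _ _) _; apply: le_trans (lerD (ler_normD _ _) (lexx _)) _.
  by lra.
(* The error divided by [tau ^ 2]; the default [0] for [n > N] keeps the relation single-valued for
   all indices. *)
pose err N n x := (0 < N)%N /\ exists un wn, let tau := T / N%:R in
  imex_scheme iota A B D Bm f g tau N u0 (iota w0) un wn /\
  x = (if (n <= N)%N then (`|u (n%:R * tau) - un n|
        + `|iota (v (n%:R * tau)) - wn n|) / tau ^+ 2 else 0).
have errU N n x y : err N n x -> err N n y -> x = y.
  move=> [N0 [un [wn [sc ->]]]] [_ [un' [wn' [sc' ->]]]].
  have [nN|//] := leqP n N.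
  have tau_gt0 : 0 < T / N%:R by rewrite divr_gt0// ltr0n.
  by have [-> ->] := imex_scheme_unique hDV hD hproj tau_gt0 a0 hAa sc sc' nN.
(* [tau > tau0] means [N < T / tau0], so [N] is at most the integer part. *)
have [C2 C20 large] := bounded_error_few_steps (Num.truncn (T / tau0)).+1 errU.
exists (C1 + C2 + 1); first by rewrite ltr_wpDl// addr_ge0.
move=> N N0 un wn tau sc n nN /=; rewrite -/v.
have tau_gt0 : 0 < tau by rewrite divr_gt0// ltr0n.
have tau2 : 0 < tau ^+ 2 by rewrite exprn_gt0.
have [sm|bg] := leP tau tau0.
  apply: le_trans (small N N0 sm un wn sc n nN) _.
  by rewrite ler_wpM2r ?(ltW tau2)// -addrA lerDl addr_ge0.
rewrite -ler_pdivrMr//; apply: (@le_trans _ _ C2); last first.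
  by rewrite addrAC lerDr addr_ge0.
apply: (large N n) => //.
  have NT : N%:R < T / tau0.
    by rewrite ltr_pdivlMr// mulrC -ltr_pdivlMr ?ltr0n.
  by rewrite ltnS truncn_ge_nat ?divr_ge0 ?(ltW hT) ?(ltW tau00)// ltW.
by split=> //; exists un, wn; split=> //; rewrite nN.
Qed.
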